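(* The Heyting algebra of the Weihrauch degrees of partial multimaps on multi-represented spaces is isomorphic to the poset of $r$-degrees of monotone operations on $\Omega$.
   Context: Let $(\mathsf N,\mathbf N,\ast)$ be one of: (i) Kleene's first algebra: $\mathsf N=\mathbf N=\mathbb N$, $e\ast n=\varphi_e(n)$ for the standard indexing of partial computable functions on $\mathbb N$; (ii) Kleene's second algebra: $\mathsf N=\mathbf N=\mathbb N^{\mathbb N}$, $x\ast y=\varphi_x(y)$ for the standard indexing $(\varphi_x)_{x\in\mathbb N^{\mathbb N}}$ of partial continuous functions on Baire space (e.g. $(x\ast y)(n)=x(\langle n,y(0),\dots,y(k-1)\rangle)-1$ for the least $k$ making $x(\cdots)>0$; $x\ast y$ is defined iff such $k$ exists for all $n$); (iii) the Kleene–Vesley algebra: $\mathbf N=\mathbb N^{\mathbb N}$ with $\ast$ as in (ii) and $\mathsf N$ the set of computable elements of $\mathbb N^{\mathbb N}$. A partial function on $\mathbf N$ is computable if for some $e\in\mathsf N$ it agrees with $x\mapsto e\ast x$ on its domain. Pairs are coded in $\mathbf N$ by a standard computable pairing. A multi-represented space is a set $X$ with a relation $\mathtt x\vdash_X x$ (''$\mathtt x$ is a name of $x$'') between $\mathbf N$ and $X$ such that every $x\in X$ has at least one name (one $\mathtt x$ may name several points). A partial multimap $f$ from $X$ to $Y$ is a partial function from $X$ to $\mathcal P(Y)$ (the value $\emptyset$ is allowed). For multi-represented spaces $X,Y,X',Y'$ and partial multimaps $f$ from $X$ to $Y$, $g$ from $X'$ to $Y'$, $f$ is Weihrauch reducible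 to $g$ iff there are partial computable $\varphi_-,\varphi_+$ on $\mathbf N$ such that for all $\mathtt x,x$ with $\mathtt x\vdash_X x\in\mathrm{dom}(f)$ there is $\tilde x\in\mathrm{dom}(g)$ with $\varphi_-(\mathtt x)\vdash_{X'}\tilde x$ such that for all $\mathtt y,y$ with $\mathtt y\vdash_{Y'}y\in g(\tilde x)$ there is $\tilde y\in f(x)$ with $\varphi_+(\mathtt x,\mathtt y)\vdash_Y\tilde y$. $\Omega=\mathcal P(\mathbf N)$. For $p,q\in\Omega$, $p\to q=\{x\in\mathbf N: x\ast a\text{ is defined and }x\ast a\in q\text{ for all }a\in p\}$. An operation $j\colon\Omega\to\Omega$ is monotone if some $e\in\mathsf N$ belongs to $(p\to q)\to(j(p)\to j(q))$ for all $p,q\in\Omega$. $j\leq_r k$ iff some $e\in\mathsf N$ belongs to $j(p)\to k(p)$ for all $p\in\Omega$. Degrees are equivalence classes of the preorder, with the induced partial order; the Heyting structure is the one determined by the order, and isomorphism means order isomorphism. *)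

(* Defs.v *)
From Stdlib Require Import List Relations FinFun.
From Stdlib Require Cantor.

Set Implicit Arguments.
Unset Strict Implicit.
Unset Printing Implicit Defensive.

Notation cpair m n := (Cantor.to_nat (m, n)).

(** Programs for unary partial recursive functions; several arguments are
    packed with Cantor pairing. *)
Inductive code : Type :=
| Zero | Succ | Fst | Snd
| Pair (f g : code)
| Comp (f g : code)
| Prec (f g : code)
| Mu (f : code).

(** [eval c n m]: program [c] on input [n] halts with output [m]. *)
Fixpoint eval (c : code) (n m : nat) {struct c} : Prop :=
  match c with
  | Zero => m = 0
  | Succ => m = S n
  | Fst => m = fst (Cantor.of_nat n)
  | Snd => m = snd (Cantor.of_nat n)
  | Pair f g => exists a b, eval f n a /\ eval g n b /\ m = cpair a b
  | Comp f g => exists a, eval g n a /\ eval f a m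
  (* h(a,0) = f(a), h(a,k+1) = g(a,(k,h(a,k))) *)
  | Prec f g =>
      let (a, k) := Cantor.of_nat n in
      nat_rect (fun _ => nat -> Prop)
        (eval f a)
        (fun i R r => exists r0, R r0 /\ eval g (cpair a (cpair i r0)) r)
        k m
  | Mu f =>
      eval f (cpair n m) 0 /\
      forall i, i < m -> exists r, eval f (cpair n i) (S r)
  end.

Fixpoint encode (c : code) : nat :=
  match c with
  | Zero => cpair 0 0
  | Succ => cpair 1 0
  | Fst => cpair 2 0
  | Snd => cpair 3 0
  | Pair f g => cpair 4 (cpair (encode f) (encode g))
  | Comp f g => cpair 5 (cpair (encode f) (encode g))
  | Prec f g => cpair 6 (cpair (encode f) (encode g))
  | Mu f => cpair 7 (encode f)
  end.

(** [phi e n m]: φ_e(n) is defined and equal to [m].  Numbers that are not the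
    code of a program index the empty function. *)
Definition phi (e n m : nat) : Prop := exists c, encode c = e /\ eval c n m.

Definition computable_seq (x : nat -> nat) : Prop :=
  exists e, forall n, phi e n (x n).

(** [app x y z] means that x∗y is defined and equal to [z]; the elements of the
    sub-algebra of realizers are those satisfying [eff]. *)
Record algebra := Algebra {
  carrier :> Set;
  eff : carrier -> Prop;
  app : carrier -> carrier -> carrier -> Prop;
  pairing : carrier -> carrier -> carrier
}.

Definition kleene1 : algebra :=
  @Algebra nat (fun _ => True) phi (fun a b => cpair a b).

Fixpoint code_list (l : list nat) : nat :=
  match l with
  | nil => 0
  | n :: l' => S (cpair n (code_list l'))
  end.

(** The number ⟨n, y(0), ..., y(k-1)⟩. *)
Definition query (n : nat) (y : nat -> nat) (k : nat) : nat :=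
  code_list (n :: map y (seq 0 k)).

Definition app2 (x y z : nat -> nat) : Prop :=
  forall n, exists k,
    x (query n y k) = S (z n) /\ forall i, i < k -> x (query n y i) = 0.

Definition pair2 (a b : nat -> nat) (n : nat) : nat :=
  if Nat.even n then a (Nat.div2 n) else b (Nat.div2 n).

Definition kleene2 : algebra :=
  @Algebra (nat -> nat) (fun _ => True) app2 pair2.

Definition kleene_vesley : algebra :=
  @Algebra (nat -> nat) computable_seq app2 pair2.

Inductive kleene_case := K1 | K2 | KV.

Definition algebra_of (K : kleene_case) : algebra :=
  match K with
  | K1 => kleene1
  | K2 => kleene2
  | KV => kleene_vesley
  end.

Definition computable_pfun (A : algebra) (f : A -> option A) : Prop :=
  exists e, eff e /\ forall x y, f x = Some y -> app e x y.

Record mrspace (A : algebra) := MRSpace {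
  point :> Type;
  names : A -> point -> Prop;
  named : forall x, exists a, names a x
}.

Record multimap (A : algebra) := Multimap {
  src : mrspace A;
  tgt : mrspace A;
  (* [None] outside the domain; the value [Some V] with [V] empty is allowed *)
  graph :> src -> option (tgt -> Prop)
}.

Definition weihrauch_le (A : algebra) (f g : multimap A) : Prop :=
  exists phim phip : A -> option A,
    computable_pfun phim /\ computable_pfun phip /\
    forall a (x : src f) V, names a x -> f x = Some V ->
      exists a' (x' : src g) W,
        phim a = Some a' /\ names a' x' /\ g x' = Some W /\
        forall b (y : tgt g), names b y -> W y ->
          exists b' y', phip (pairing a b) = Some b' /\ names b' y' /\ V y'.

Definition Omega (A : algebra) : Type := A -> Prop.

Definition imp (A : algebra) (p q : Omega A) : Omega A :=
  fun x => forall a, p a -> exists b, app x a b /\ q b.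

Definition monotone (A : algebra) (j : Omega A -> Omega A) : Prop :=
  exists e, eff e /\ forall p q, imp (imp p q) (imp (j p) (j q)) e.

Definition monotone_op (A : algebra) : Type :=
  { j : Omega A -> Omega A | monotone j }.

Definition r_le (A : algebra) (j k : monotone_op A) : Prop :=
  exists e, eff e /\ forall p, imp (proj1_sig j p) (proj1_sig k p) e.

Definition degree (T : Type) (le : relation T) : Type :=
  { C : T -> Prop | exists x, forall y, C y <-> le x y /\ le y x }.

Definition degree_le (T : Type) (le : relation T) : relation (degree le) :=
  fun C D => exists x y, proj1_sig C x /\ proj1_sig D y /\ le x y.
Arguments degree_le {T} le _ _.

Section OrderTheory.
Context (P : Type) (le : relation P).

Definition is_meet (a b m : P) : Prop :=
  forall c, le c m <-> le c a /\ le c b.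

Definition is_join (a b m : P) : Prop :=
  forall c, le m c <-> le a c /\ le b c.

Definition is_himp (a b i : P) : Prop :=
  forall c m, is_meet c a m -> (le c i <-> le m b).

Record heyting : Prop := {
  heyting_order : order P le;
  heyting_bot : exists x, forall y, le x y;
  heyting_top : exists x, forall y, le y x;
  heyting_meet : forall a b, exists m, is_meet a b m;
  heyting_join : forall a b, exists m, is_join a b m;
  heyting_himp : forall a b, exists i, is_himp a b i
}.
End OrderTheory.

Definition order_isomorphic (P Q : Type) (leP : relation P) (leQ : relation Q)
  : Prop :=
  exists F : P -> Q, Bijective F /\ forall a b, leP a b <-> leQ (F a) (F b).

(* Main.v *)
Require Import Defs.
From Stdlib Require Import Arith Lia Relations.
From Stdlib Require Import Classical ClassicalEpsilon.
From Stdlib Require Import FunctionalExtensionality PropExtensionality.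
From Stdlib Require Cantor.

Set Implicit Arguments.
Unset Strict Implicit.
Unset Printing Implicit Defensive.

(** A multimap f gives an operation on truth values: f(p) consists of the pairs of a
    name of an instance x of f and of a function taking the names of the solutions
    in f(x) into p. It is monotone, by composing with the function. An inequality
    between two such operations is exactly a Weihrauch reduction: evaluate it at
    the truth value of the names of the solutions, with the identity as function
    ([weihrauch_le_instances]). Every monotone operation j arises in this way, up
    to equivalence, from the multimap whose instances are the truth values p, named
    by the realizers of j(p), and whose solutions at p are the elements of p
    ([instance_op_surjective]). Hence the two posets of degrees are isomorphic
    ([degrees_isomorphic]).

    The Heyting structure is found among the monotone operations and then moved
    along the isomorphism. Meets and joins are taken pointwise, as products and
    disjoint sums; the implication from j to k sends p to the intersection over
    all q of (p -> q) -> (j(q) -> k(q)) ([r_le_himp_op]).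

    All this holds over any partial combinatory algebra with effective pairing and
    a subalgebra of effective elements ([weihrauch_degrees_of_pca]). Realizers are
    written as lambda terms, and typing rules with truth values as types show that
    they work ([term_realizer]).

    It remains to see that the three algebras are of this kind. For Kleene's first
    algebra this needs a universal program, obtained from a stack machine whose
    single steps are computable ([steps_eval], [universal]), and parametrization
    ([curry_code]). For sequences, a combinator is specified by a computable
    operator on finite stages of its arguments that approximates the result
    ([curry_operator]), and application itself is such an operator
    ([approx_apply]). As the combinators are computable sequences and these are
    closed under application, the second algebra and the Kleene-Vesley algebra are
    covered together ([pca_baire]). *)


(** * Degrees of a preorder *)

Section Degrees.
Context (T : Type) (le : relation T) (pre : preorder T le).

Definition cls (x : T) : degree le :=
  exist _ (fun y => le x y /\ le y x) (ex_intro _ x (fun y => iff_refl _)).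

(** Classes are compared through their members: the defining existential is a
    proposition, so extensionality and proof irrelevance suffice. *)
Lemma degree_ext (C D : degree le) :
  (forall x, proj1_sig C x <-> proj1_sig D x) -> C = D.
Proof.
  destruct C as [C HC], D as [D HD]; simpl; intros E.
  assert (C = D) as <-.
  { extensionality x. apply propositional_extensionality, E. }
  f_equal. apply proof_irrelevance.
Qed.

Lemma cls_surj (C : degree le) : exists x, C = cls x.
Proof.
  destruct (proj2_sig C) as [x Hx]. exists x. now apply degree_ext.
Qed.

Lemma degree_le_cls (x y : T) : degree_le le (cls x) (cls y) <-> le x y.
Proof.
  destruct pre as [Hr Ht].
  split.
  - intros (x' & y' & [H1 _] & [_ H2] & H). simpl in *.
    exact (Ht _ _ _ H1 (Ht _ _ _ H H2)).
  - intros H. exists x, y. simpl. auto.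
Qed.

Lemma order_degree_le : order (degree le) (degree_le le).
Proof.
  destruct pre as [Hr Ht]. constructor.
  - intros C. destruct (cls_surj C) as [x ->]. apply degree_le_cls, Hr.
  - intros C D E. destruct (cls_surj C) as [x ->], (cls_surj D) as [y ->],
      (cls_surj E) as [z ->]. rewrite !degree_le_cls. apply Ht.
  - intros C D. destruct (cls_surj C) as [x ->], (cls_surj D) as [y ->].
    rewrite !degree_le_cls. intros H1 H2. apply degree_ext. intros z; simpl.
    split; intros [H3 H4]; split; eapply Ht; eassumption.
Qed.

Lemma is_meet_cls (a b m : T) :
  is_meet le a b m -> is_meet (degree_le le) (cls a) (cls b) (cls m).
Proof.
  intros H C. destruct (cls_surj C) as [c ->]. rewrite !degree_le_cls. apply H.
Qed.

Lemma is_join_cls (a b m : T) :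
  is_join le a b m -> is_join (degree_le le) (cls a) (cls b) (cls m).
Proof.
  intros H C. destruct (cls_surj C) as [c ->]. rewrite !degree_le_cls. apply H.
Qed.

Lemma is_himp_cls (a b i : T) :
  is_himp le a b i -> is_himp (degree_le le) (cls a) (cls b) (cls i).
Proof.
  intros H C M HM. destruct (cls_surj C) as [c ->], (cls_surj M) as [m ->].
  rewrite !degree_le_cls. apply H. intros d. specialize (HM (cls d)).
  now rewrite !degree_le_cls in HM.
Qed.

Lemma heyting_degrees :
  (exists x, forall y, le x y) -> (exists x, forall y, le y x) ->
  (forall a b, exists m, is_meet le a b m) ->
  (forall a b, exists m, is_join le a b m) ->
  (forall a b, exists i, is_himp le a b i) ->
  heyting (degree_le le).
Proof.
  intros [b Hb] [t Ht] Hm Hj Hi. constructor.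
  - apply order_degree_le.
  - exists (cls b). intros C. destruct (cls_surj C) as [c ->].
    now apply degree_le_cls.
  - exists (cls t). intros C. destruct (cls_surj C) as [c ->].
    now apply degree_le_cls.
  - intros C D. destruct (cls_surj C) as [c ->], (cls_surj D) as [d ->].
    destruct (Hm c d) as [m H]. exists (cls m). now apply is_meet_cls.
  - intros C D. destruct (cls_surj C) as [c ->], (cls_surj D) as [d ->].
    destruct (Hj c d) as [m H]. exists (cls m). now apply is_join_cls.
  - intros C D. destruct (cls_surj C) as [c ->], (cls_surj D) as [d ->].
    destruct (Hi c d) as [m H]. exists (cls m). now apply is_himp_cls.
Qed.

End Degrees.

(** An order embedding that is surjective up to equivalence. The inverse pulls a
    class back along [J], so no representatives have to be chosen. *)
Lemma degrees_isomorphic (S T : Type) (leS : relation S) (leT : relation T)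
    (J : S -> T) :
  preorder S leS -> preorder T leT ->
  (forall x y, leS x y <-> leT (J x) (J y)) ->
  (forall y, exists x, leT (J x) y /\ leT y (J x)) ->
  order_isomorphic (degree_le leS) (degree_le leT).
Proof.
  intros preS preT HJ Hsurj.
  pose proof (preord_refl _ _ preT) as Hr.
  pose proof (preord_trans _ _ preT) as Ht.
  assert (HF : forall C : degree leS, exists z, forall y,
    (exists x, proj1_sig C x /\ leT (J x) y /\ leT y (J x)) <-> leT z y /\ leT y z).
  { intros C. destruct (cls_surj C) as [x ->]. exists (J x). intros y. split.
    - intros (x' & [H1 H2] & H3 & H4). apply HJ in H1, H2.
      split; eapply Ht; eassumption.
    - intros [H1 H2]. exists x. simpl. repeat split; trivial;
        apply (preord_refl _ _ preS). }
  assert (HG : forall D : degree leT, exists z, forall x,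
    proj1_sig D (J x) <-> leS z x /\ leS x z).
  { intros D. destruct (cls_surj D) as [y ->]. destruct (Hsurj y) as (z & H1 & H2).
    exists z. intros x. simpl. rewrite !HJ. split; intros [H3 H4];
      split; eapply Ht; eassumption. }
  pose (F := fun C => exist _ _ (HF C) : degree leT).
  pose (G := fun D => exist _ _ (HG D) : degree leS).
  assert (EF : forall x, F (cls leS x) = cls leT (J x)).
  { intros x. apply degree_ext. intros y. simpl. split.
    - intros (x' & [H1 H2] & H3 & H4). apply HJ in H1, H2.
      split; eapply Ht; eassumption.
    - intros [H1 H2]. exists x. repeat split; trivial;
        apply (preord_refl _ _ preS). }
  exists F. split.
  - exists G. split.
    + intros C. destruct (cls_surj C) as [x ->]. rewrite EF.
      apply degree_ext. intros y. simpl. now rewrite !HJ.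
    + intros D. destruct (cls_surj D) as [y ->]. apply degree_ext.
      intros z. simpl. split.
      * intros (x & [H1 H2] & H3 & H4). split; eapply Ht; eassumption.
      * intros [H1 H2]. destruct (Hsurj y) as (x & H3 & H4).
        exists x. repeat split; trivial; eapply Ht; eassumption.
  - intros C D. destruct (cls_surj C) as [x ->], (cls_surj D) as [y ->].
    rewrite !EF, !degree_le_cls by assumption. apply HJ.
Qed.

(** Each operation is computed on the side of [Q] and moved back by the inverse,
    which is adjoint to [F] on both sides. *)
Lemma heyting_isomorphic (P Q : Type) (leP : relation P) (leQ : relation Q) :
  order_isomorphic leP leQ -> heyting leQ -> heyting leP.
Proof.
  intros (F & (G & GF & FG) & HF) [[Hr Ht Ha] [b Hb] [t Htop] Hm Hj Hi].
  assert (HG : forall x y, leQ x (F y) <-> leP (G x) y).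
  { intros x y. now rewrite HF, FG. }
  assert (HG' : forall x y, leQ (F x) y <-> leP x (G y)).
  { intros x y. now rewrite HF, FG. }
  constructor.
  - constructor.
    + intros x. apply HF, Hr.
    + intros x y z. rewrite !HF. apply Ht.
    + intros x y H1 H2. apply HF in H1, H2. rewrite <- (GF x), <- (GF y).
      f_equal. now apply Ha.
  - exists (G b). intros y. apply HG, Hb.
  - exists (G t). intros y. apply HG', Htop.
  - intros x y. destruct (Hm (F x) (F y)) as [m H]. exists (G m).
    intros z. rewrite <- HG', !HF. apply H.
  - intros x y. destruct (Hj (F x) (F y)) as [m H]. exists (G m).
    intros z. rewrite <- HG, !HF. apply H.
  - intros x y. destruct (Hi (F x) (F y)) as [i H]. exists (G i).
    intros z m Hz. rewrite <- HG', HF. apply H.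
    intros w. rewrite <- (FG w), <- !HF. apply Hz.
Qed.

(** * Realizers in a partial combinatory algebra *)

(** The equations are required in one direction only: an application must be
    defined as soon as the corresponding composite of applications is. *)
Record pca (A : algebra) : Type := Pca {
  app_fun : forall x y z z' : A, app x y z -> app x y z' -> z = z';
  app_eff : forall x y z : A, eff x -> eff y -> app x y z -> eff z;
  kc : A;
  sc : A;
  pairc : A;
  fstc : A;
  sndc : A;
  eff_combinators : eff kc /\ eff sc /\ eff pairc /\ eff fstc /\ eff sndc;
  kc_app : forall a, exists u, app kc a u /\ forall b, app u b a;
  sc_app : forall a, exists u, app sc a u /\
    forall b, exists v, app u b v /\
    forall c d e r, app a c d -> app b c e -> app d e r -> app v c r;
  pairc_app : forall a, exists u, app pairc a u /\
    forall b, app u b (pairing a b);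
  fstc_app : forall a b, app fstc (pairing a b) a;
  sndc_app : forall a b, app sndc (pairing a b) b
}.

Section Terms.
Context (A : algebra) (P : pca A).

(** Applicative polynomials, with de Bruijn indices so that an abstraction is
    again such a term. *)
Inductive term : Type :=
| Var (i : nat)
| Cst (a : A)
| App (t u : term).

Definition scons (a : A) (rho : nat -> A) (i : nat) : A :=
  match i with 0 => a | S j => rho j end.

Inductive ev (rho : nat -> A) : term -> A -> Prop :=
| ev_var i : ev rho (Var i) (rho i)
| ev_cst a : ev rho (Cst a) a
| ev_app t u a b c : ev rho t a -> ev rho u b -> app a b c -> ev rho (App t u) c.

Fixpoint effective (t : term) : Prop :=
  match t with
  | Var _ => True
  | Cst a => eff a
  | App t u => effective t /\ effective u
  end.

(** Bracket abstraction. Constants are guarded by [kc] and applications by [sc],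
    so that an abstraction always has a value even if its body has none. *)
Fixpoint Lam (t : term) : term :=
  match t with
  | Var 0 => App (App (Cst (sc P)) (Cst (kc P))) (Cst (kc P))
  | Var (S i) => App (Cst (kc P)) (Var i)
  | Cst a => App (Cst (kc P)) (Cst a)
  | App t u => App (App (Cst (sc P)) (Lam t)) (Lam u)
  end.

Definition PairT (t u : term) : term := App (App (Cst (pairc P)) t) u.
Definition FstT (t : term) : term := App (Cst (fstc P)) t.
Definition SndT (t : term) : term := App (Cst (sndc P)) t.

Lemma effective_lam t : effective t -> effective (Lam t).
Proof.
  pose proof (eff_combinators P).
  induction t as [[|i]|a|t IHt u IHu]; simpl; intuition.
Qed.

Lemma ev_fun rho t v w : ev rho t v -> ev rho t w -> v = w.
Proof.
  intros H. revert w. induction H as [i|a|t u a b c _ IHt _ IHu Hc]; intros w Hw;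
    inversion Hw; subst; trivial.
  rewrite <- (IHt _ H1), <- (IHu _ H2) in H4. eapply (app_fun P); eassumption.
Qed.

Lemma ev_eff rho t v :
  (forall i, eff (rho i)) -> effective t -> ev rho t v -> eff v.
Proof.
  intros Hr Ht H. induction H as [i|a|t u a b c _ IHt _ IHu Hc]; simpl in Ht.
  - apply Hr.
  - exact Ht.
  - destruct Ht. eapply (app_eff P); [apply IHt | apply IHu | exact Hc]; assumption.
Qed.

Lemma ev_lam rho t : exists v, ev rho (Lam t) v /\
  forall a w, ev (scons a rho) t w -> app v a w.
Proof.
  induction t as [[|i]|b|t IHt u IHu]; simpl.
  - destruct (sc_app P (kc P)) as (u & Hu & H). destruct (H (kc P)) as (v & Hv & Hsk).
    exists v. split; [repeat (econstructor; eauto)|].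
    intros a w Hw. inversion Hw; subst; simpl.
    destruct (kc_app P a) as (u' & Hu' & Hk). eapply Hsk; eauto.
  - destruct (kc_app P (rho i)) as (u & Hu & H).
    exists u. split; [repeat (econstructor; eauto)|].
    intros a w Hw. inversion Hw; subst; simpl. apply H.
  - destruct (kc_app P b) as (u & Hu & H).
    exists u. split; [repeat (econstructor; eauto)|].
    intros a w Hw. inversion Hw; subst; simpl. apply H.
  - destruct IHt as (vt & Hvt & Ht), IHu as (vu & Hvu & Hu).
    destruct (sc_app P vt) as (x & Hx & H). destruct (H vu) as (v & Hv & Hs).
    exists v. split; [repeat (econstructor; eauto)|].
    intros a w Hw. inversion Hw; subst; simpl. eapply Hs; eauto.
Qed.

(** Typing judgements, with truth values as types. Realizers are obtained below
    by deriving such a judgement; the derivation never mentions the value of the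
    term, and this is what makes one term serve uniformly for all truth
    values. *)
Definition sat (rho : nat -> A) (t : term) (q : Omega A) : Prop :=
  exists v, ev rho t v /\ q v.

Definition omega_prod (p q : Omega A) : Omega A :=
  fun x => exists a b, x = pairing a b /\ p a /\ q b.

Lemma sat_var rho i (q : Omega A) : q (rho i) -> sat rho (Var i) q.
Proof. intros H. exists (rho i). split; [constructor | exact H]. Qed.

Lemma sat_cst rho a (q : Omega A) : q a -> sat rho (Cst a) q.
Proof. intros H. exists a. split; [constructor | exact H]. Qed.

Lemma sat_app rho t u (p q : Omega A) :
  sat rho t (imp p q) -> sat rho u p -> sat rho (App t u) q.
Proof.
  intros (x & Hx & H) (a & Ha & Hp). destruct (H a Hp) as (b & Hb & Hq).
  exists b. split; [econstructor; eassumption | exact Hq].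
Qed.

Lemma sat_lam rho t (p q : Omega A) :
  (forall a, p a -> sat (scons a rho) t q) -> sat rho (Lam t) (imp p q).
Proof.
  intros H. destruct (ev_lam rho t) as (v & Hv & Ht). exists v. split; trivial.
  intros a Ha. destruct (H a Ha) as (w & Hw & Hq). exists w. auto.
Qed.

Lemma sat_pair rho t u (p q : Omega A) :
  sat rho t p -> sat rho u q -> sat rho (PairT t u) (omega_prod p q).
Proof.
  intros (a & Ha & Hp) (b & Hb & Hq). destruct (pairc_app P a) as (x & Hx & H).
  exists (pairing a b). split.
  - repeat (econstructor; eauto).
  - exists a, b. auto.
Qed.

Lemma sat_fst rho t (p q : Omega A) : sat rho t (omega_prod p q) -> sat rho (FstT t) p.
Proof.
  apply sat_app, sat_cst. intros x (a & b & -> & Ha & Hb). exists a.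
  split; trivial. apply fstc_app.
Qed.

Lemma sat_snd rho t (p q : Omega A) : sat rho t (omega_prod p q) -> sat rho (SndT t) q.
Proof.
  apply sat_app, sat_cst. intros x (a & b & -> & Ha & Hb). exists b.
  split; trivial. apply sndc_app.
Qed.

Lemma sat_weaken rho t (p q : Omega A) :
  (forall x, p x -> q x) -> sat rho t p -> sat rho t q.
Proof. intros H (x & Hx & Hp). exists x. auto. Qed.

(** A term has at most one value, so values found separately for each [i] agree;
    the index type has to be inhabited for there to be a value. *)
Lemma sat_all rho t (I : Type) (i0 : I) (Q : I -> Omega A) :
  (forall i, sat rho t (Q i)) -> sat rho t (fun x => forall i, Q i x).
Proof.
  intros H. destruct (H i0) as (v & Hv & _). exists v. split; trivial.
  intros i. destruct (H i) as (w & Hw & Hq). now rewrite (ev_fun Hv Hw).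
Qed.

(** The realizer is chosen before the truth values: a term with constants among
    the effective elements yields one effective element for all typings. *)
Lemma term_realizer (t : term) :
  effective t ->
  exists e, eff e /\ forall p q : Omega A,
    (forall rho a, p a -> sat (scons a rho) t q) -> imp p q e.
Proof.
  intros Ht. destruct (ev_lam (fun _ => kc P) t) as (e & He & H).
  exists e. split.
  - eapply ev_eff; [| |exact He]; [|now apply effective_lam].
    intros i. apply eff_combinators.
  - intros p q Hpq a Ha. destruct (Hpq (fun _ => kc P) a Ha) as (b & Hb & Hq).
    exists b. auto.
Qed.

End Terms.

Arguments Var {A} i.
Arguments term_realizer {A} P t _.
Ltac effective_tac P :=
  pose proof (eff_combinators P); simpl;
  repeat first [apply effective_lam; simpl | split]; tauto.

(** * Weihrauch reducibility as inclusion of monotone operations *)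

Section Operations.
Context (A : algebra) (P : pca A).
Notation Omega := (Omega A).

Lemma preorder_r_le : preorder _ (@r_le A).
Proof.
  constructor.
  - intros j. destruct (term_realizer P (Var 0)) as (e & He & H); [exact I|].
    exists e. split; trivial. intros p. apply H. intros rho a Ha.
    now apply sat_var.
  - intros h j k (e & He & H) (e' & He' & H').
    destruct (term_realizer P (App (Cst e') (App (Cst e) (Var 0))))
      as (r & Hr & Hrel); [effective_tac P|].
    exists r. split; trivial. intros p. apply Hrel. intros rho a Ha.
    eapply sat_app; [apply sat_cst, H'|].
    eapply sat_app; [apply sat_cst, H|]. now apply sat_var.
Qed.

Lemma monotone_realizer (j : Omega -> Omega) (t : term A) :
  effective t ->
  (forall p q rho h a, imp p q h -> j p a -> sat (scons a (scons h rho)) t (j q)) ->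
  monotone j.
Proof.
  intros Ht H. destruct (term_realizer P (Lam P t)) as (e & He & Hrel).
  - now apply effective_lam.
  - exists e. split; trivial. intros p q. apply Hrel. intros rho h Hh.
    apply sat_lam. intros a Ha. now apply (H p).
Qed.

Definition values (f : multimap A) (V : tgt f -> Prop) : Omega :=
  fun b => exists y, names b y /\ V y.

(** The operation attached to a multimap: a realizer of [instances f p] is a
    question to [f], that is, a name of a point of the domain, with a function
    turning every answer into a realizer of [p]. *)
Definition instances (f : multimap A) (p : Omega) : Omega :=
  fun c => exists x V, f x = Some V /\
    omega_prod (fun a => names a x) (imp (values V) p) c.

Lemma monotone_instances (f : multimap A) : monotone (instances f).
Proof.
  apply monotone_realizer with
    (t := PairT P (FstT P (Var 0)) (Lam P (App (Var 2) (App (SndT P (Var 1)) (Var 0))))).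
  - effective_tac P.
  - intros p q rho h c Hh (x & V & HV & Hc).
    apply sat_weaken with (p := omega_prod (fun a => names a x) (imp (values V) q)).
    { intros z Hz. exists x, V. auto. }
    apply sat_pair.
    + eapply sat_fst, sat_var, Hc.
    + apply sat_lam. intros b Hb.
      eapply sat_app; [apply sat_var, Hh|].
      eapply sat_app; [eapply sat_snd, sat_var, Hc | apply sat_var, Hb].
Qed.

Definition instance_op (f : multimap A) : monotone_op A :=
  exist _ (instances f) (monotone_instances f).

(** Reductions ask for partial functions with values in an option type, so it has to
    be decided whether an application is defined. As application is single-valued,
    the value chosen is the one found for the instance at hand. *)
Definition partial_application (e a : A) : option A :=
  match excluded_middle_informative (exists b, app e a b) with
  | left H => Some (proj1_sig (constructive_indefinite_description _ H))
  | right _ => None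
  end.

Lemma computable_partial_application (e : A) :
  eff e -> computable_pfun (partial_application e).
Proof.
  intros He. exists e. split; trivial. intros x y. unfold partial_application.
  destruct (excluded_middle_informative _) as [H|H]; [|discriminate].
  intros E. injection E as <-. apply proj2_sig.
Qed.

Lemma partial_application_app (e a b : A) :
  app e a b -> partial_application e a = Some b.
Proof.
  intros H. unfold partial_application.
  destruct (excluded_middle_informative _) as [H'|H'].
  - f_equal. apply (app_fun P) with e a; trivial. apply proj2_sig.
  - destruct H'. eauto.
Qed.

Lemma weihrauch_le_of_realizers (f g : multimap A) (e e' : A) :
  eff e -> eff e' ->
  (forall a (x : src f) V, names a x -> f x = Some V ->
    exists (x' : src g) W, g x' = Some W /\
      imp (eq a) (fun a' => names a' x') e /\
      forall b, values W b -> imp (eq (pairing a b)) (values V) e') ->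
  weihrauch_le f g.
Proof.
  intros He He' H. exists (partial_application e), (partial_application e').
  split; [now apply computable_partial_application|].
  split; [now apply computable_partial_application|].
  intros a x V Ha HV. destruct (H a x V Ha HV) as (x' & W & HW & H1 & H2).
  destruct (H1 a eq_refl) as (a' & Ea' & Ha'). exists a', x', W.
  split; [now apply partial_application_app|]. do 2 (split; [assumption|]).
  intros b y Hb Hy. destruct (H2 b (ex_intro _ y (conj Hb Hy)) _ eq_refl)
    as (b' & Eb' & y' & Hy'). exists b', y'.
  split; [now apply partial_application_app | exact Hy'].
Qed.

(** From left to right, [phim] translates the question and [phip], composed with
    the given continuation, translates the answers. From right to left, the
    realizer is applied to a question with the identity as continuation, at the
    truth value formed by the names of the solutions: what comes back is a
    question to [g] with a continuation producing solutions. *)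
Lemma weihrauch_le_instances (f g : multimap A) :
  weihrauch_le f g <-> r_le (instance_op f) (instance_op g).
Proof.
  split.
  - intros (phim & phip & (e & He & Hm) & (e' & He' & Hp) & H).
    destruct (term_realizer P
      (PairT P (App (Cst e) (FstT P (Var 0)))
        (Lam P (App (SndT P (Var 1))
          (App (Cst e') (PairT P (FstT P (Var 1)) (Var 0)))))))
      as (r & Hr & Hrel); [effective_tac P|].
    exists r. split; trivial. intros p. apply Hrel.
    intros rho c (x & V & HV & a & u & -> & Ha & Hu).
    destruct (H a x V Ha HV) as (a' & x' & W & Ea' & Ha' & HW & H').
    apply sat_weaken with (p := omega_prod (fun a => names a x') (imp (values W) p)).
    { intros z Hz. exists x', W. auto. }
    assert (Hc : omega_prod (eq a) (imp (values V) p) (pairing a u)).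
    { exists a, u. auto. }
    apply sat_pair.
    + apply sat_app with (p := eq a); [apply sat_cst | eapply sat_fst, sat_var, Hc].
      intros _ <-. exists a'. auto.
    + apply sat_lam. intros b (y & Hb & Hy).
      destruct (H' b y Hb Hy) as (b' & y' & Eb' & Hb' & Hy').
      eapply sat_app; [eapply sat_snd, sat_var, Hc|].
      apply sat_app with (p := omega_prod (eq a) (eq b)).
      * apply sat_cst. intros z (a1 & b1 & -> & <- & <-). exists b'.
        split; [now apply Hp | exists y'; auto].
      * apply sat_pair; [eapply sat_fst, sat_var, Hc | now apply sat_var].
  - intros (r & Hr & H). simpl in H.
    (* Both translations recompute the element c below, which depends on the name a
       only; this is why they agree on the instance x' of g. *)
    destruct (term_realizer P (Var 0)) as (id & Hid & Hidrel); [exact I|].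
    pose (ask := fun t => App (Cst r) (PairT P t (Cst id))).
    assert (Hask : forall a (x : src f) V, names a x -> f x = Some V ->
      exists c, instances g (values V) c /\
        forall rho t, sat rho t (eq a) -> sat rho (ask t) (eq c)).
    { intros a x V Ha HV. destruct (H (values V) (pairing a id)) as (c & Hrc & Hc).
      - exists x, V. split; trivial. exists a, id. repeat split; trivial.
        apply Hidrel. intros rho b Hb. now apply sat_var.
      - exists c. split; trivial. intros rho t Ht.
        apply sat_app with (p := omega_prod (eq a) (eq id)).
        + apply sat_cst. intros z (a1 & b1 & -> & <- & <-). exists c. auto.
        + apply sat_pair; [exact Ht | now apply sat_cst]. }
    destruct (term_realizer P (FstT P (ask (Var 0)))) as (e & He & Hm);
      [effective_tac P|].
    destruct (term_realizer P (App (SndT P (ask (FstT P (Var 0)))) (SndT P (Var 0))))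
      as (e' & He' & Hp); [effective_tac P|].
    apply weihrauch_le_of_realizers with e e'; trivial.
    intros a x V Ha HV. destruct (Hask a x V Ha HV) as (c & Hc & Hac).
    destruct Hc as (x' & W & HW & Hc). exists x', W. split; trivial.
    assert (Hac' : forall rho t, sat rho t (eq a) -> sat rho (ask t)
      (omega_prod (fun a' => names a' x') (imp (values W) (values V)))).
    { intros rho t Ht. eapply sat_weaken; [|apply Hac, Ht]. now intros _ <-. }
    split.
    + apply Hm. intros rho _ <-. eapply sat_fst, Hac', sat_var, eq_refl.
    + intros b Hb. apply Hp. intros rho _ <-.
      assert (Hab : forall rho, sat (scons (pairing a b) rho) (Var 0)
        (omega_prod (eq a) (eq b))).
      { intros rho'. apply sat_var. exists a, b. auto. }
      eapply sat_app; [eapply sat_snd, Hac', sat_fst, Hab|].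
      eapply sat_weaken; [|eapply sat_snd, Hab]. now intros _ <-.
Qed.

(** The points of the source are the truth values [p] with [j p] inhabited, named
    by the realizers of [j p], and any element of [p] answers the question [p].
    Here an element names many points at once, and [p] may be empty: this uses
    both multi-representations and empty values. *)
Definition op_multimap (j : Omega -> Omega) : multimap A :=
  @Multimap A
    (@MRSpace A {p : Omega | exists a, j p a}
      (fun a p => j (proj1_sig p) a) (fun p => proj2_sig p))
    (@MRSpace A A eq (fun a => ex_intro _ a eq_refl))
    (fun p => Some (proj1_sig p)).

(** One direction is monotonicity of [j]; in the other, a realizer of [j p] is a
    question which is answered by the realizers of [p], so the identity is a
    suitable continuation. *)
Lemma instance_op_surjective (j : monotone_op A) :
  exists f, r_le (instance_op f) j /\ r_le j (instance_op f).
Proof.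
  destruct j as [j Hj]. exists (op_multimap j). unfold r_le; simpl. split.
  - destruct Hj as (m & Hm & Hj).
    destruct (term_realizer P (App (App (Cst m) (SndT P (Var 0))) (FstT P (Var 0))))
      as (e & He & Hrel); [effective_tac P|].
    exists e. split; trivial. intros q. apply Hrel.
    intros rho c ([p Hp] & V & HV & Hc). simpl in *. injection HV as <-.
    apply sat_app with (p := j p); [|eapply sat_fst, sat_var, Hc].
    eapply sat_app; [apply sat_cst, Hj|].
    eapply sat_weaken; [|eapply sat_snd, sat_var, Hc].
    intros u Hu b Hb. apply Hu. exists b. now split.
  - destruct (term_realizer P (PairT P (Var 0) (Lam P (Var 0))))
      as (e & He & Hrel); [effective_tac P|].
    exists e. split; trivial. intros p. apply Hrel. intros rho a Ha.
    pose (x := exist _ p (ex_intro _ a Ha) : src (op_multimap j)).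
    apply sat_weaken with (p := omega_prod (fun a => names a x)
      (imp (values (f := op_multimap j) p) p)).
    { intros z Hz. exists x, p. auto. }
    apply sat_pair; [now apply sat_var|].
    apply sat_lam. intros b (y & -> & Hy). now apply sat_var.
Qed.

Lemma preorder_weihrauch_le : preorder _ (@weihrauch_le A).
Proof.
  destruct preorder_r_le as [Hr Ht]. constructor.
  - intros f. apply weihrauch_le_instances, Hr.
  - intros f g h. rewrite !weihrauch_le_instances. apply Ht.
Qed.

(** * Lattice structure *)

Lemma monotone_meet (j k : Omega -> Omega) :
  monotone j -> monotone k -> monotone (fun p => omega_prod (j p) (k p)).
Proof.
  intros (e & He & H) (e' & He' & H').
  apply monotone_realizer with
    (t := PairT P (App (App (Cst e) (Var 1)) (FstT P (Var 0)))
               (App (App (Cst e') (Var 1)) (SndT P (Var 0)))).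
  - effective_tac P.
  - intros p q rho h c Hh Hc. apply sat_pair.
    + apply sat_app with (p := j p); [|eapply sat_fst, sat_var, Hc].
      eapply sat_app; [apply sat_cst, H | apply sat_var, Hh].
    + apply sat_app with (p := k p); [|eapply sat_snd, sat_var, Hc].
      eapply sat_app; [apply sat_cst, H' | apply sat_var, Hh].
Qed.

Definition meet_op (j k : monotone_op A) : monotone_op A :=
  exist _ _ (monotone_meet (proj2_sig j) (proj2_sig k)).

Lemma is_meet_meet_op (j k : monotone_op A) : is_meet (@r_le A) j k (meet_op j k).
Proof.
  intros h. split.
  - intros (e & He & H). simpl in H.
    destruct (term_realizer P (FstT P (App (Cst e) (Var 0)))) as (r & Hr & Hrel);
      [effective_tac P|].
    destruct (term_realizer P (SndT P (App (Cst e) (Var 0)))) as (r' & Hr' & Hrel');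
      [effective_tac P|].
    split; [exists r | exists r']; split; trivial; intros p.
    + apply Hrel. intros rho a Ha. eapply sat_fst, sat_app;
        [apply sat_cst, H | now apply sat_var].
    + apply Hrel'. intros rho a Ha. eapply sat_snd, sat_app;
        [apply sat_cst, H | now apply sat_var].
  - intros [(e & He & H) (e' & He' & H')].
    destruct (term_realizer P (PairT P (App (Cst e) (Var 0)) (App (Cst e') (Var 0))))
      as (r & Hr & Hrel); [effective_tac P|].
    exists r. split; trivial. intros p. apply Hrel. intros rho a Ha.
    apply sat_pair.
    + eapply sat_app; [apply sat_cst, H | apply sat_var, Ha].
    + eapply sat_app; [apply sat_cst, H' | apply sat_var, Ha].
Qed.

(** The formula is the implication of natural transformations: the intersection
    over all [q] above [p] of the implications from [j q] to [k q], where being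
    above [p] is witnessed by a realizer given as an argument. Pointwise
    implication would not be monotone in [p]. *)
Definition himp_fun (j k : Omega -> Omega) (p : Omega) : Omega :=
  fun x => forall q, imp (imp p q) (imp (j q) (k q)) x.

Lemma monotone_himp (j k : Omega -> Omega) : monotone (himp_fun j k).
Proof.
  apply monotone_realizer with
    (t := Lam P (App (Var 1) (Lam P (App (Var 1) (App (Var 3) (Var 0)))))).
  - effective_tac P.
  - intros p q rho h x Hh Hx. apply (sat_all P p). intros r.
    apply sat_lam. intros u Hu.
    apply sat_app with (p := imp p r); [apply sat_var, Hx|].
    apply sat_lam. intros a Ha.
    eapply sat_app; [apply sat_var, Hu|].
    eapply sat_app; [apply sat_var, Hh | apply sat_var, Ha].
Qed.

Definition himp_op (j k : monotone_op A) : monotone_op A :=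
  exist _ _ (monotone_himp (proj1_sig j) (proj1_sig k)).

(** Forwards, the implication is used at [q := p] with the identity. Backwards,
    monotonicity of [h] moves its realizer from [p] to [q]. *)
Lemma r_le_himp_op (h j k : monotone_op A) :
  r_le h (himp_op j k) <-> r_le (meet_op h j) k.
Proof.
  split.
  - intros (e & He & H). simpl in H.
    destruct (term_realizer P
      (App (App (App (Cst e) (FstT P (Var 0))) (Lam P (Var 0))) (SndT P (Var 0))))
      as (r & Hr & Hrel); [effective_tac P|].
    exists r. split; trivial. intros p. apply Hrel. intros rho c Hc. simpl in Hc.
    apply sat_app with (p := proj1_sig j p); [|eapply sat_snd, sat_var, Hc].
    apply sat_app with (p := imp p p).
    + apply sat_weaken with (p := himp_fun (proj1_sig j) (proj1_sig k) p).
      { intros z Hz. apply Hz. }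
      eapply sat_app; [apply sat_cst, H | eapply sat_fst, sat_var, Hc].
    + apply sat_lam. intros a Ha. now apply sat_var.
  - intros (e & He & H). simpl in H. destruct h as [h (m & Hm & Hh)].
    simpl in H.
    destruct (term_realizer P
      (Lam P (Lam P (App (Cst e)
        (PairT P (App (App (Cst m) (Var 1)) (Var 2)) (Var 0))))))
      as (r & Hr & Hrel); [effective_tac P|].
    exists r. split; trivial. intros p. apply Hrel. intros rho a Ha. simpl in Ha.
    apply (sat_all P p). intros q.
    apply sat_lam. intros u Hu. apply sat_lam. intros b Hb.
    eapply sat_app; [apply sat_cst, H|]. apply sat_pair; [|apply sat_var, Hb].
    apply sat_app with (p := h p); [|apply sat_var, Ha].
    eapply sat_app; [apply sat_cst, Hh | apply sat_var, Hu].
Qed.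

Lemma is_himp_himp_op (j k : monotone_op A) :
  is_himp (@r_le A) j k (himp_op j k).
Proof.
  intros h m Hm. rewrite r_le_himp_op.
  destruct preorder_r_le as [Hr Ht].
  assert (r_le m (meet_op h j) /\ r_le (meet_op h j) m) as [H1 H2].
  { split; [apply is_meet_meet_op, Hm, Hr | apply Hm, is_meet_meet_op, Hr]. }
  split; intros H; eapply Ht; eassumption.
Qed.

Lemma kc_first_argument (p q : Omega) : imp p (imp q p) (kc P).
Proof.
  intros a Ha. destruct (kc_app P a) as (u & Hu & H). exists u. split; trivial.
  intros b _. exists a. auto.
Qed.

(** The two tags of the disjoint sum are the two projections, so that a tag
    performs the case distinction by being applied to the two branches. *)
Lemma second_argument : exists F : A, eff F /\ forall p q, imp p (imp q q) F.
Proof.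
  destruct (term_realizer P (Lam P (Var 0))) as (F & HF & H); [effective_tac P|].
  exists F. split; trivial. intros p q. apply H. intros rho a _.
  apply sat_lam. intros b Hb. now apply sat_var.
Qed.

Definition tagged (F : A) (p q : Omega) : Omega :=
  fun c => omega_prod (eq (kc P)) p c \/ omega_prod (eq F) q c.

(** The branches are applied to the payload only after one of them has been
    selected: both need a value, but only the selected one has to be defined at
    the payload. *)
Definition if_term (t u : term A) : term A :=
  App (App (App (FstT P (Var 0)) t) u) (SndT P (Var 0)).

Lemma sat_if_term (F : A) (HF : forall p q, imp p (imp q q) F) rho c t u
    (p q r : Omega) :
  tagged F p q c ->
  sat (scons c rho) t (imp p r) -> sat (scons c rho) u (imp q r) ->
  sat (scons c rho) (if_term t u) r.
Proof.
  intros [Hc|Hc] Ht Hu.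
  - apply sat_app with (p := p); [|eapply sat_snd, sat_var, Hc].
    eapply sat_app; [eapply sat_app; [|exact Ht]|exact Hu].
    eapply sat_weaken; [|eapply sat_fst, sat_var, Hc].
    intros _ <-. apply kc_first_argument.
  - apply sat_app with (p := q); [|eapply sat_snd, sat_var, Hc].
    eapply sat_app; [eapply sat_app; [|exact Ht]|exact Hu].
    eapply sat_weaken; [|eapply sat_fst, sat_var, Hc].
    intros _ <-. apply HF.
Qed.

Lemma join_exists (j k : monotone_op A) : exists m, is_join (@r_le A) j k m.
Proof.
  destruct second_argument as (F & HFe & HF).
  assert (Hm : monotone (fun p => tagged F (proj1_sig j p) (proj1_sig k p))).
  { destruct j as [j (e & He & H)], k as [k (e' & He' & H')]; simpl.
    apply monotone_realizer with
      (t := if_term (Lam P (PairT P (Cst (kc P)) (App (App (Cst e) (Var 2)) (Var 0))))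
                    (Lam P (PairT P (Cst F) (App (App (Cst e') (Var 2)) (Var 0))))).
    - effective_tac P.
    - intros p q rho h c Hh Hc. apply (sat_if_term HF Hc).
      + apply sat_lam. intros a Ha.
        apply sat_weaken with (p := omega_prod (eq (kc P)) (j q)); [now left|].
        apply sat_pair; [now apply sat_cst|].
        eapply sat_app; [|apply sat_var, Ha].
        eapply sat_app; [apply sat_cst, H | apply sat_var, Hh].
      + apply sat_lam. intros a Ha.
        apply sat_weaken with (p := omega_prod (eq F) (k q)); [now right|].
        apply sat_pair; [now apply sat_cst|].
        eapply sat_app; [|apply sat_var, Ha].
        eapply sat_app; [apply sat_cst, H' | apply sat_var, Hh]. }
  exists (exist _ _ Hm). intros h. unfold r_le; simpl. split.
  - intros (e & He & H).
    destruct (term_realizer P (App (Cst e) (PairT P (Cst (kc P)) (Var 0))))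
      as (r & Hr & Hrel); [effective_tac P|].
    destruct (term_realizer P (App (Cst e) (PairT P (Cst F) (Var 0))))
      as (r' & Hr' & Hrel'); [effective_tac P|].
    split; [exists r | exists r']; split; trivial; intros p.
    + apply Hrel. intros rho a Ha. eapply sat_app; [apply sat_cst, H|].
      apply sat_weaken with (p := omega_prod (eq (kc P)) (proj1_sig j p)); [now left|].
      apply sat_pair; [now apply sat_cst | apply sat_var, Ha].
    + apply Hrel'. intros rho a Ha. eapply sat_app; [apply sat_cst, H|].
      apply sat_weaken with (p := omega_prod (eq F) (proj1_sig k p)); [now right|].
      apply sat_pair; [now apply sat_cst | apply sat_var, Ha].
  - intros [(e & He & H) (e' & He' & H')].
    destruct (term_realizer P (if_term (Cst e) (Cst e'))) as (r & Hr & Hrel);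
      [effective_tac P|].
    exists r. split; trivial. intros p. apply Hrel. intros rho c Hc.
    apply (sat_if_term HF Hc); apply sat_cst; [apply H | apply H'].
Qed.

Lemma heyting_r_degrees : heyting (degree_le (@r_le A)).
Proof.
  pose proof (eff_combinators P) as (Hk & _).
  apply heyting_degrees.
  - apply preorder_r_le.
  - assert (H : monotone (fun _ : Omega => (fun _ => False) : Omega)).
    { exists (kc P). split; trivial. intros p q h _.
      destruct (kc_app P h) as (u & Hu & _). exists u. split; trivial.
      intros a []. }
    exists (exist _ _ H). intros j. exists (kc P).
    split; [exact Hk | intros p a []].
  - destruct (term_realizer P (Var 0)) as (id & Hid & Hrel); [exact I|].
    assert (Hr : forall p : Omega, imp p (fun _ => True) id).
    { intros p. apply Hrel. intros rho a _. now apply sat_var. }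
    assert (H : monotone (fun _ : Omega => (fun _ => True) : Omega)).
    { apply monotone_realizer with (t := Var 0); [exact I|].
      intros p q rho h a _ _. now apply sat_var. }
    exists (exist _ _ H). intros j. exists id.
    split; [exact Hid | intros p; apply Hr].
  - intros j k. exists (meet_op j k). apply is_meet_meet_op.
  - apply join_exists.
  - intros j k. exists (himp_op j k). apply is_himp_himp_op.
Qed.

Theorem weihrauch_degrees_of_pca :
  heyting (degree_le (@weihrauch_le A)) /\
  order_isomorphic (degree_le (@weihrauch_le A)) (degree_le (@r_le A)).
Proof.
  assert (H : order_isomorphic (degree_le (@weihrauch_le A)) (degree_le (@r_le A))).
  { apply degrees_isomorphic with (J := instance_op).
    - apply preorder_weihrauch_le.
    - apply preorder_r_le.
    - apply weihrauch_le_instances.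
    - apply instance_op_surjective. }
  split; trivial. eapply heyting_isomorphic; [exact H | apply heyting_r_degrees].
Qed.

End Operations.


(** * Total computable functions *)

Local Arguments Cantor.to_nat : simpl never.
Local Arguments Cantor.of_nat : simpl never.

Definition p1 (n : nat) : nat := fst (Cantor.of_nat n).
Definition p2 (n : nat) : nat := snd (Cantor.of_nat n).

Lemma p1_pair a b : p1 (cpair a b) = a.
Proof. unfold p1. now rewrite Cantor.cancel_of_to. Qed.

Lemma p2_pair a b : p2 (cpair a b) = b.
Proof. unfold p2. now rewrite Cantor.cancel_of_to. Qed.

Lemma pair_p1_p2 n : cpair (p1 n) (p2 n) = n.
Proof.
  unfold p1, p2. rewrite <- surjective_pairing. apply Cantor.cancel_to_of.
Qed.

Lemma cpair_inj a b c d : cpair a b = cpair c d -> a = c /\ b = d.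
Proof.
  intros H. split.
  - apply (f_equal p1) in H. now rewrite !p1_pair in H.
  - apply (f_equal p2) in H. now rewrite !p2_pair in H.
Qed.

Definition computable (f : nat -> nat) : Prop :=
  exists c, forall n, eval c n (f n).

Lemma computable_ext f g : (forall n, f n = g n) -> computable f -> computable g.
Proof. intros E [c H]. exists c. intros n. rewrite <- E. apply H. Qed.

Lemma computable_compose f g :
  computable f -> computable g -> computable (fun n => f (g n)).
Proof. intros [c H] [d K]. exists (Comp c d). intros n. simpl. eauto. Qed.

Lemma computable_pair f g :
  computable f -> computable g -> computable (fun n => cpair (f n) (g n)).
Proof. intros [c H] [d K]. exists (Pair c d). intros n. simpl. eauto 6. Qed.

Definition id_code : code := Pair Fst Snd.

Lemma eval_id n : eval id_code n n.
Proof.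
  simpl. exists (p1 n), (p2 n). repeat split. symmetry. apply pair_p1_p2.
Qed.

Lemma computable_id : computable (fun n => n).
Proof. exists id_code. apply eval_id. Qed.

Lemma computable_p1 f : computable f -> computable (fun n => p1 (f n)).
Proof. apply computable_compose with (f := p1). exists Fst. reflexivity. Qed.

Lemma computable_p2 f : computable f -> computable (fun n => p2 (f n)).
Proof. apply computable_compose with (f := p2). exists Snd. reflexivity. Qed.

Lemma computable_S f : computable f -> computable (fun n => S (f n)).
Proof. apply computable_compose with (f := S). exists Succ. reflexivity. Qed.

Fixpoint const_code (a : nat) : code :=
  match a with 0 => Zero | S a' => Comp Succ (const_code a') end.

Lemma eval_const a n : eval (const_code a) n a.
Proof. induction a as [|a IH]; simpl; eauto. Qed.

Lemma computable_const a : computable (fun _ => a).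
Proof. exists (const_code a). apply eval_const. Qed.

Lemma computable_binary (f : nat -> nat -> nat) a b :
  computable (fun t => f (p1 t) (p2 t)) -> computable a -> computable b ->
  computable (fun n => f (a n) (b n)).
Proof.
  intros Hf Ha Hb.
  apply computable_ext with (f := fun n =>
    (fun t => f (p1 t) (p2 t)) (cpair (a n) (b n))).
  - intros n. simpl. now rewrite p1_pair, p2_pair.
  - apply computable_compose with (f := fun t => f (p1 t) (p2 t)); trivial.
    now apply computable_pair.
Qed.

(** The step function [g] receives the parameter, the index and the previous
    value, which a program reads off as the nested pair of these. *)
Lemma computable_rec f k (g : nat -> nat -> nat -> nat) :
  computable f -> computable k ->
  computable (fun t => g (p1 t) (p1 (p2 t)) (p2 (p2 t))) ->
  computable (fun n => nat_rect (fun _ => nat) (f n) (fun i r => g n i r) (k n)).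
Proof.
  intros [cf Hf] [ck Hk] [cg Hg].
  exists (Comp (Prec cf cg) (Pair id_code ck)). intros n.
  exists (cpair n (k n)). split.
  - exists n, (k n). repeat split; trivial. apply eval_id.
  - simpl. rewrite Cantor.cancel_of_to.
    induction (k n) as [|i IH]; simpl; [apply Hf|].
    eexists. split; [exact IH|].
    specialize (Hg (cpair n (cpair i (nat_rect (fun _ => nat) (f n)
      (fun i r => g n i r) i)))).
    now rewrite p1_pair, p2_pair, p1_pair, p2_pair in Hg.
Qed.

Lemma computable_pred f : computable f -> computable (fun n => pred (f n)).
Proof.
  intros Hf. apply computable_ext with
    (f := fun n => nat_rect (fun _ => nat) 0 (fun i r => i) (f n)).
  - intros n. now destruct (f n).
  - apply (computable_rec (g := fun n i r => i)); trivial.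
    + apply computable_const.
    + apply computable_p1, computable_p2, computable_id.
Qed.

Definition ifz (k x y : nat) : nat := match k with 0 => x | S _ => y end.

Lemma computable_ifz k x y : computable k -> computable x -> computable y ->
  computable (fun n => ifz (k n) (x n) (y n)).
Proof.
  intros Hk Hx Hy. apply computable_ext with
    (f := fun n => nat_rect (fun _ => nat) (x n) (fun i r => y n) (k n)).
  - intros n. now destruct (k n).
  - apply (computable_rec (g := fun n i r => y n)); trivial.
    apply computable_compose with (f := y); trivial.
    apply computable_p1, computable_id.
Qed.

Create HintDb comp.
Local Hint Resolve computable_id computable_const computable_pair computable_p1
  computable_p2 computable_S computable_pred computable_ifz : comp.

(** * A universal program *)

Lemma eval_fun c : forall n m m', eval c n m -> eval c n m' -> m = m'.
Proof.
  induction c as [| | | |f IHf g IHg|f IHf g IHg|f IHf g IHg|f IHf];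
    simpl; intros n m m'; try congruence.
  - intros (a & b & Ha & Hb & ->) (a' & b' & Ha' & Hb' & ->).
    now rewrite (IHf _ _ _ Ha Ha'), (IHg _ _ _ Hb Hb').
  - intros (a & Ha & H) (a' & Ha' & H'). rewrite (IHg _ _ _ Ha Ha') in H. eauto.
  - destruct (Cantor.of_nat n) as [a k]. revert m m'.
    induction k as [|k IHk]; simpl; intros m m'; [apply IHf|].
    intros (r & Hr & H) (r' & Hr' & H'). rewrite (IHk _ _ Hr Hr') in H. eauto.
  - intros [H0 H] [H0' H'].
    destruct (lt_eq_lt_dec m m') as [[Hlt|He]|Hlt]; trivial; exfalso.
    + destruct (H' _ Hlt) as [r Hr]. now specialize (IHf _ _ _ H0 Hr).
    + destruct (H _ Hlt) as [r Hr]. now specialize (IHf _ _ _ H0' Hr).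
Qed.

(** Consequently an index determines its program, and the application of the
    first algebra is single-valued. *)
Lemma encode_inj c : forall d, encode c = encode d -> c = d.
Proof.
  induction c; intros []; simpl; intros E; apply cpair_inj in E as [Et E];
    try discriminate Et; trivial;
    try (apply cpair_inj in E as [E1 E2]); f_equal; auto.
Qed.

Lemma phi_fun e n m m' : phi e n m -> phi e n m' -> m = m'.
Proof.
  intros (c & Ec & H) (d & Ed & H'). rewrite <- Ed in Ec.
  apply encode_inj in Ec as ->. eapply eval_fun; eassumption.
Qed.

Lemma computable_seq_iff x : computable_seq x <-> computable x.
Proof.
  split.
  - intros [e H]. destruct (H 0) as (c & Ec & _). exists c. intros n.
    destruct (H n) as (d & Ed & Hd). rewrite <- Ed in Ec.
    now apply encode_inj in Ec as ->.
  - intros [c H]. exists (encode c). intros n. exists c. auto.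
Qed.

(** Coded stacks have 0 as the empty stack. *)
Definition push (frame stack : nat) : nat := S (cpair frame stack).

Fixpoint select (tag : nat) (l : list nat) : nat :=
  match l with
  | nil => 0
  | cons x l' => ifz tag x (select (pred tag) l')
  end.


(** A state is a stack of frames with a current value. A frame is a tagged number;
    the codes of programs are themselves the frames with tags 0 to 7, meaning that
    the program is to be applied to the current value, and the tags 8 to 11
    record what remains to be done after a subcomputation. Thus a transition
    only inspects the top frame, and no course-of-values recursion over
    computations is needed. *)
Definition transition (tag x rest v : nat) : nat :=
  select tag (
  (* Zero *) cpair rest 0 ::
  (* Succ *) cpair rest (S v) ::
  (* Fst *) cpair rest (p1 v) ::
  (* Snd *) cpair rest (p2 v) ::
  (* Pair f g *)
  cpair (push (p1 x) (push (cpair 8 (cpair (p2 x) v)) rest)) v ::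
  (* Comp f g *)
  cpair (push (p2 x) (push (p1 x) rest)) v ::
  (* Prec f g *)
  cpair (push (p1 x)
          (push (cpair 10 (cpair (p2 x) (cpair (p1 v) (cpair 0 (p2 v))))) rest))
        (p1 v) ::
  (* Mu f *)
  cpair (push x (push (cpair 11 (cpair x (cpair v 0))) rest)) (cpair v 0) ::
  (* first component of a pair computed; the code of the second one and the input
     are waiting *)
  cpair (push (p1 x) (push (cpair 9 v) rest)) (p2 x) ::
  (* second component of a pair computed, the first one is waiting *)
  cpair rest (cpair x v) ::
  (* stage i of a recursion with parameter a reached, k stages to go *)
  (let g := p1 x in let a := p1 (p2 x) in
   let i := p1 (p2 (p2 x)) in let k := p2 (p2 (p2 x)) in
   ifz k (cpair rest v)
     (cpair (push g
              (push (cpair 10 (cpair g (cpair a (cpair (S i) (pred k))))) rest))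
            (cpair a (cpair i v)))) ::
  (* the test of a minimization on input n computed at i *)
  (let f := p1 x in let n := p1 (p2 x) in let i := p2 (p2 x) in
   ifz v (cpair rest i)
     (cpair (push f (push (cpair 11 (cpair f (cpair n (S i)))) rest))
            (cpair n (S i)))) :: nil)%list.

Definition step (s : nat) : nat :=
  let q := pred (p1 s) in
  ifz (p1 s) s (transition (p1 (p1 q)) (p2 (p1 q)) (p2 q) (p2 s)).

Lemma step_push tag x rest v :
  step (cpair (push (cpair tag x) rest) v) = transition tag x rest v.
Proof.
  unfold step, push. cbv zeta. rewrite p1_pair. cbn [pred ifz].
  now rewrite !p1_pair, !p2_pair.
Qed.

Lemma computable_transition t x r v :
  computable t -> computable x -> computable r -> computable v ->
  computable (fun n => transition (t n) (x n) (r n) (v n)).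
Proof.
  intros Ht Hx Hr Hv. unfold transition, push. cbn [select].
  repeat first [ assumption | apply computable_const
    | apply computable_ifz | apply computable_pair | apply computable_p1
    | apply computable_p2 | apply computable_S | apply computable_pred ].
Qed.

Lemma computable_step : computable step.
Proof.
  unfold step. apply computable_ifz; auto with comp.
  apply computable_transition; auto 8 with comp.
Qed.

Definition run (s t : nat) : nat := Nat.iter t step s.

Lemma computable_run : computable (fun w => run (p1 w) (p2 w)).
Proof.
  apply (computable_rec (g := fun n i r => step r)); auto with comp.
  apply computable_compose with (f := step); auto with comp.
  apply computable_step.
Qed.

Definition steps (s s' : nat) : Prop := exists t, run s t = s'.

Lemma steps_refl s : steps s s.
Proof. now exists 0. Qed.

Lemma steps_step s s' : steps (step s) s' -> steps s s'.
Proof.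
  intros [t H]. exists (S t). rewrite <- H. unfold run. apply Nat.iter_succ_r.
Qed.

Lemma steps_trans s s' s'' : steps s s' -> steps s' s'' -> steps s s''.
Proof.
  intros [t <-] [t' <-]. exists (t' + t). apply Nat.iter_add.
Qed.

Ltac exec := apply steps_step; rewrite step_push;
  cbn [transition select ifz pred];
  repeat first [rewrite p1_pair | rewrite p2_pair]; cbn [ifz pred].

(** The stack below the program is arbitrary; this is what makes the induction
    work, as subprograms are run on top of pending frames. *)
Lemma steps_eval c : forall n m rest,
  eval c n m -> steps (cpair (push (encode c) rest) n) (cpair rest m).
Proof.
  induction c as [| | | |f IHf g IHg|f IHf g IHg|f IHf g IHg|f IHf];
    simpl; intros n m rest.
  - intros ->. exec. apply steps_refl.
  - intros ->. exec. apply steps_refl.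
  - intros ->. exec. apply steps_refl.
  - intros ->. exec. apply steps_refl.
  - intros (a & b & Ha & Hb & ->). exec.
    eapply steps_trans; [apply IHf, Ha|]. exec.
    eapply steps_trans; [apply IHg, Hb|]. exec. apply steps_refl.
  - intros (a & Ha & Hm). exec.
    eapply steps_trans; [apply IHg, Ha|]. apply IHf, Hm.
  - rewrite <- (pair_p1_p2 n), Cantor.cancel_of_to.
    generalize (p1 n) (p2 n). clear n. intros a k H.
    pose (loop := fun i j =>
      push (cpair 10 (cpair (encode g) (cpair a (cpair i j)))) rest).
    assert (Hloop : forall i r, nat_rect (fun _ => nat -> Prop) (eval f a)
        (fun i R r => exists r0, R r0 /\ eval g (cpair a (cpair i r0)) r) i r ->
      forall j, steps (cpair (push (encode f) (loop 0 (i + j))) a)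
                      (cpair (loop i j) r)).
    { clear H. induction i as [|i IH]; simpl; intros r.
      - intros Hr j. apply IHf, Hr.
      - intros (r0 & Hr0 & Hr) j.
        specialize (IH _ Hr0 (S j)). rewrite Nat.add_succ_r in IH.
        eapply steps_trans; [exact IH|]. unfold loop at 1. exec. apply IHg, Hr. }
    specialize (Hloop _ _ H 0). rewrite Nat.add_0_r in Hloop.
    exec. eapply steps_trans; [exact Hloop|]. unfold loop. exec. apply steps_refl.
  - intros [H0 H].
    pose (loop := fun i => cpair
      (push (encode f) (push (cpair 11 (cpair (encode f) (cpair n i))) rest))
      (cpair n i)).
    assert (Hloop : forall i, i <= m -> steps (loop 0) (loop i)).
    { induction i as [|i IH]; intros Hi; [apply steps_refl|].
      destruct (H i Hi) as [r Hr]. eapply steps_trans; [apply IH; lia|].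
      eapply steps_trans; [apply IHf, Hr|]. exec. apply steps_refl. }
    exec. eapply steps_trans; [apply (Hloop m); lia|].
    eapply steps_trans; [apply IHf, H0|]. exec. apply steps_refl.
Qed.

Lemma run_halted s t t' : t <= t' -> p1 (run s t) = 0 -> run s t' = run s t.
Proof.
  intros Hle H. induction Hle as [|t' Hle IH]; trivial.
  change (run s (S t')) with (step (run s t')). rewrite IH.
  unfold step. now rewrite H.
Qed.

Lemma least_zero (f : nat -> nat) n : f n = 0 ->
  exists m, f m = 0 /\ forall i, i < m -> exists r, f i = S r.
Proof.
  revert f. induction n as [|n IH]; intros f Hn.
  - exists 0. split; trivial. lia.
  - destruct (f 0) as [|r] eqn:E0.
    + exists 0. split; trivial. lia.
    + destruct (IH (fun i => f (S i)) Hn) as (m & Hm & H). exists (S m).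
      split; trivial. intros [|i] Hi; [eauto | apply H; lia].
Qed.

(** Search for the number of transitions after which the stack is empty. *)
Lemma universal : exists u, forall e n m, phi e n m -> eval u (cpair e n) m.
Proof.
  pose (init := fun w => cpair (push (p1 w) 0) (p2 w)).
  assert (Hinit : computable init).
  { unfold init, push. auto 8 with comp. }
  destruct computable_run as [run_code Hrun], Hinit as [init_code Hinit].
  exists (Comp (Comp Snd run_code)
    (Comp (Pair id_code (Mu (Comp Fst run_code))) init_code)).
  intros _ n m (c & <- & Hc).
  destruct (steps_eval 0 Hc) as [t Ht].
  set (s := cpair (push (encode c) 0) n) in Ht.
  assert (Es : init (cpair (encode c) n) = s).
  { unfold init. now rewrite p1_pair, p2_pair. }
  destruct (@least_zero (fun t => p1 (run s t)) t) as (t0 & H0 & Hlt).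
  { now rewrite Ht, p1_pair. }
  assert (Ht0 : run s t0 = cpair 0 m).
  { destruct (Nat.le_ge_cases t t0) as [Hle|Hle].
    - rewrite (run_halted Hle); trivial. now rewrite Ht, p1_pair.
    - now rewrite <- (run_halted Hle). }
  assert (Hrun' : forall i, eval run_code (cpair s i) (run s i)).
  { intros i. specialize (Hrun (cpair s i)). now rewrite p1_pair, p2_pair in Hrun. }
  assert (Hinit' := Hinit (cpair (encode c) n)). rewrite Es in Hinit'.
  exists (cpair s t0). split.
  - exists s. split; trivial. exists s, t0.
    split; [apply eval_id|]. split; [|reflexivity]. split.
    + exists (run s t0). split; [apply Hrun'|]. symmetry. exact H0.
    + intros i Hi. destruct (Hlt i Hi) as [r Hr]. exists r, (run s i).
      split; [apply Hrun'|]. symmetry. exact Hr.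
  - exists (run s t0). split; [apply Hrun'|]. rewrite Ht0.
    symmetry. apply p2_pair.
Qed.

(** * Kleene's first algebra *)

Lemma computable_encode_const f :
  computable f -> computable (fun n => encode (const_code (f n))).
Proof.
  apply computable_compose with (f := fun n => encode (const_code n)).
  apply computable_ext with (f := fun n => nat_rect (fun _ => nat)
    (encode Zero) (fun _ r => cpair 5 (cpair (encode Succ) r)) n).
  - intros n. induction n as [|n IH]; trivial. simpl in *. now rewrite IH.
  - apply (computable_rec
      (g := fun _ _ r => cpair 5 (cpair (encode Succ) r))); auto 8 with comp.
Qed.

(** Parametrization: the index of the program with its first argument filled in is
    computable from that argument. *)
Lemma curry_code c : exists d, forall a, exists u, eval d a u /\
  forall b m, eval c (cpair a b) m -> phi u b m.
Proof.
  pose (fix_first := fun a => Comp c (Pair (const_code a) id_code)).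
  assert (H : computable (fun a => encode (fix_first a))).
  { simpl. repeat apply computable_pair; auto 3 with comp.
    apply computable_encode_const, computable_id. }
  destruct H as [d Hd]. exists d. intros a. exists (encode (fix_first a)).
  split; trivial. intros b m Hm. exists (fix_first a). split; trivial.
  exists (cpair a b). split; trivial. exists a, b.
  repeat split; [apply eval_const | apply eval_id].
Qed.

Lemma curry2_code c : exists d, forall a, exists u, eval d a u /\
  forall b, exists v, phi u b v /\
  forall x m, eval c (cpair (cpair a b) x) m -> phi v x m.
Proof.
  destruct (curry_code c) as [d Hd], (curry_code d) as [d' Hd'].
  exists d'. intros a. destruct (Hd' a) as (u & Hu & H). exists u.
  split; trivial. intros b. destruct (Hd (cpair a b)) as (v & Hv & H').
  exists v. auto.
Qed.

Lemma pca_kleene1 : inhabited (pca kleene1).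
Proof.
  assert (Hphi : forall c n m, eval c n m -> phi (encode c) n m).
  { intros c n m H. exists c. auto. }
  destruct (curry_code Fst) as [k Hk].
  destruct (curry_code id_code) as [p Hp].
  destruct universal as [u Hu].
  destruct (curry2_code
    (Comp u (Pair (Comp u (Pair (Comp Fst Fst) Snd))
                  (Comp u (Pair (Comp Snd Fst) Snd))))) as [s Hs].
  constructor.
  apply (@Pca kleene1) with (kc := encode k) (sc := encode s)
    (pairc := encode p) (fstc := encode Fst) (sndc := encode Snd);
    simpl; trivial.
  - exact phi_fun.
  - tauto.
  - intros a. destruct (Hk a) as (v & Hv & H). exists v. split; [auto|].
    intros b. apply H. symmetry. apply p1_pair.
  - intros a. destruct (Hs a) as (v & Hv & H). exists v. split; [auto|].
    intros b. destruct (H b) as (w & Hw & H'). exists w. split; trivial.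
    intros x d e r Hd He Hr. apply H'. simpl.
    fold (p1 (cpair (cpair a b) x)). fold (p2 (cpair (cpair a b) x)).
    exists (cpair d e). split; [|apply Hu, Hr].
    exists d, e. repeat split.
    + exists (cpair a x). split; [|apply Hu, Hd].
      exists a, x. repeat split; [|now rewrite p2_pair].
      exists (cpair a b). rewrite p1_pair. split; trivial.
      symmetry; apply p1_pair.
    + exists (cpair b x). split; [|apply Hu, He].
      exists b, x. repeat split; [|now rewrite p2_pair].
      exists (cpair a b). rewrite p1_pair. split; trivial.
      symmetry; apply p2_pair.
  - intros a. destruct (Hp a) as (v & Hv & H). exists v. split; [auto|].
    intros b. apply H, eval_id.
  - intros a b. apply (Hphi Fst). symmetry. apply p1_pair.
  - intros a b. apply (Hphi Snd). symmetry. apply p2_pair.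
Qed.

(** * Finite approximations of sequences *)

Notation baire := (nat -> nat).

Definition prefix (y : baire) (k : nat) : nat := code_list (List.map y (List.seq 0 k)).

Lemma query_prefix n y k : query n y k = S (cpair n (prefix y k)).
Proof. reflexivity. Qed.

(** [X t i] is what is known after [t] steps about the value at [i]: 0 if nothing,
    [S v] if the value is [v]. Information is always correct and is eventually
    available for good, with no uniformity in [i]. *)
Definition approx (X : nat -> baire) (x : baire) : Prop :=
  (forall t i v, X t i = S v -> v = x i) /\
  (forall i, exists T, forall t, T <= t -> X t i = S (x i)).

(** The prefix of length [k] from partial information about a sequence: 0 if some
    entry is unknown, else the successor of its code. The recursion conses from
    the last entry backwards, whence the index [k - S i]. *)
Definition guarded_prefix (Y : baire) (k : nat) : nat :=
  nat_rect (fun _ => nat) 1 (fun i r =>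
    ifz r 0 (ifz (Y (k - S i)) 0 (S (S (cpair (pred (Y (k - S i))) (pred r)))))) k.

Lemma guarded_prefix_aux (Y : baire) (y : baire) k :
  (forall i v, Y i = S v -> v = y i) ->
  forall j, j <= k ->
  let r := nat_rect (fun _ => nat) 1 (fun i r =>
    ifz r 0 (ifz (Y (k - S i)) 0 (S (S (cpair (pred (Y (k - S i))) (pred r)))))) j in
  (r = 0 \/ r = S (code_list (List.map y (List.seq (k - j) j)))) /\
  ((forall i, i < k -> Y i <> 0) -> r <> 0).
Proof.
  intros HY. induction j as [|j IH]; intros Hj; simpl.
  - split; auto.
  - destruct (IH ltac:(lia)) as [[E|E] H]; simpl in E, H; rewrite E in *; clear E.
    + simpl. auto.
    + simpl. destruct (Y (k - S j)) as [|v] eqn:Ev; simpl.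
      * split; auto. intros H'. exfalso. apply (H' (k - S j)); [lia | trivial].
      * split; [right | discriminate]. apply HY in Ev as ->.
        replace (S (k - S j)) with (k - j) by lia. reflexivity.
Qed.

Lemma guarded_prefix_sound (Y : baire) y k : (forall i v, Y i = S v -> v = y i) ->
  guarded_prefix Y k = 0 \/ guarded_prefix Y k = S (prefix y k).
Proof.
  intros HY. destruct (guarded_prefix_aux HY (le_n k)) as [H _].
  now rewrite Nat.sub_diag in H.
Qed.

Lemma guarded_prefix_full (Y : baire) y k : (forall i v, Y i = S v -> v = y i) ->
  (forall i, i < k -> Y i <> 0) -> guarded_prefix Y k = S (prefix y k).
Proof.
  intros HY H. destruct (guarded_prefix_sound k HY) as [E|E]; trivial.
  destruct (guarded_prefix_aux HY (le_n k)) as [_ H']. now destruct (H' H).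
Qed.

(** The outcome of asking at stage [k] of an application: 0 if the answer is to
    read more, 1 if information is missing, [S (S v)] if the result is [v]. The
    search below stops at the first outcome other than 0; in particular it stops
    at missing information, since an answer found later might not come from the
    least stage. *)
Definition probe (X Y : baire) (n k : nat) : nat :=
  ifz (guarded_prefix Y k) 1 (
    let w := X (S (cpair n (pred (guarded_prefix Y k)))) in
    ifz w 1 (ifz (pred w) 0 w)).

Definition search (X Y : baire) (n t : nat) : nat :=
  nat_rect (fun _ => nat) 0 (fun k r => ifz r (probe X Y n k) r) t.

Definition apply_approx (X Y : baire) (t n : nat) : nat := pred (search X Y n t).

Lemma probe_sound (X Y x y : baire) n k :
  (forall i v, X i = S v -> v = x i) -> (forall i v, Y i = S v -> v = y i) ->
  probe X Y n k = 0 /\ x (query n y k) = 0 \/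
  probe X Y n k = 1 \/
  exists v, probe X Y n k = S (S v) /\ x (query n y k) = S v.
Proof.
  intros HX HY. unfold probe.
  destruct (guarded_prefix_sound k HY) as [-> | ->]; simpl; auto.
  rewrite <- query_prefix.
  destruct (X (query n y k)) as [|[|v]] eqn:E; simpl; auto; apply HX in E; eauto.
Qed.

Lemma probe_complete (X Y x y : baire) n k :
  (forall i v, Y i = S v -> v = y i) -> (forall i, i < k -> Y i <> 0) ->
  X (query n y k) = S (x (query n y k)) ->
  probe X Y n k = ifz (x (query n y k)) 0 (S (x (query n y k))).
Proof.
  intros HY Hk HX. unfold probe. rewrite (guarded_prefix_full HY Hk). simpl.
  rewrite <- query_prefix, HX. simpl. now destruct (x (query n y k)).
Qed.

Lemma search_sound (X Y x y : baire) n t :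
  (forall i v, X i = S v -> v = x i) -> (forall i v, Y i = S v -> v = y i) ->
  search X Y n t = 0 /\ (forall k, k < t -> x (query n y k) = 0) \/
  search X Y n t = 1 \/
  exists k v, search X Y n t = S (S v) /\ x (query n y k) = S v /\
    forall i, i < k -> x (query n y i) = 0.
Proof.
  intros HX HY. induction t as [|t IH]; simpl.
  { left. split; trivial. lia. }
  destruct IH as [[E H]|[E|(k & v & E & H)]].
  - rewrite E. simpl.
    destruct (probe_sound n t HX HY) as [[-> H'] | [-> | (v & -> & H')]]; simpl.
    + left. split; trivial. intros k Hk.
      destruct (Nat.eq_dec k t) as [->|]; [trivial | apply H; lia].
    + auto.
    + right; right. exists t, v. auto.
  - rewrite E. auto.
  - rewrite E. simpl. right; right. exists k, v. auto.
Qed.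

Lemma approx_below (X : nat -> baire) x (f : baire) k : approx X x ->
  exists T, forall t, T <= t -> forall i, i < k -> X t (f i) = S (x (f i)).
Proof.
  intros [_ HX]. induction k as [|k [T HT]]; [exists 0; lia|].
  destruct (HX (f k)) as [T' HT']. exists (T + T'). intros t Ht i Hi.
  destruct (Nat.eq_dec i k) as [->|]; [apply HT'; lia | apply HT; lia].
Qed.

(** Application is continuous: approximations of the arguments yield
    approximations of the value. *)
Lemma approx_apply (X Y : nat -> baire) x y z :
  approx X x -> approx Y y -> app2 x y z ->
  approx (fun t => apply_approx (X t) (Y t) t) z.
Proof.
  intros HX HY Hz. split.
  - intros t n v. unfold apply_approx.
    destruct (search_sound n t (proj1 HX t) (proj1 HY t))
      as [[-> _] | [-> | (k & w & -> & Hw & Hlt)]]; try discriminate.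
    intros E. injection E as ->. destruct (Hz n) as (k' & Hk' & Hlt').
    destruct (lt_eq_lt_dec k k') as [[H|<-]|H].
    + rewrite (Hlt' k H) in Hw. discriminate.
    + congruence.
    + rewrite (Hlt k' H) in Hk'. discriminate.
  - intros n. destruct (Hz n) as (k & Hk & Hlt).
    destruct (approx_below (query n y) (S k) HX) as [T HT].
    destruct (approx_below (fun i => i) k HY) as [T' HT'].
    exists (S (T + T' + k)). intros t Ht.
    assert (Hprobe : forall i, i <= k -> probe (X t) (Y t) n i =
        ifz (x (query n y i)) 0 (S (x (query n y i)))).
    { intros i Hi. apply probe_complete.
      - apply HY.
      - intros j Hj. rewrite HT'; lia.
      - apply HT; lia. }
    assert (Hbefore : forall i, i <= k -> search (X t) (Y t) n i = 0).
    { induction i as [|i IH]; intros Hi; trivial. simpl.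
      rewrite IH by lia. simpl. rewrite Hprobe, Hlt by lia. reflexivity. }
    assert (Hafter : forall j, search (X t) (Y t) n (S k + j) = S (S (z n))).
    { induction j as [|j IH].
      - rewrite Nat.add_0_r. simpl. rewrite Hbefore by lia. simpl.
        rewrite Hprobe, Hk by lia. reflexivity.
      - rewrite Nat.add_succ_r. change (ifz (search (X t) (Y t) n (S k + j))
          (probe (X t) (Y t) n (S k + j)) (search (X t) (Y t) n (S k + j))
          = S (S (z n))). now rewrite IH. }
    unfold apply_approx. replace t with (S k + (t - S k)) at 3 by lia.
    now rewrite Hafter.
Qed.

(** * Currying *)

Definition hd (q : nat) : nat := p1 (pred q).
Definition tl (q : nat) : nat := p2 (pred q).

Definition lookup (l i : nat) : nat :=
  let t := nat_rect (fun _ => nat) l (fun _ r => tl r) i in ifz t 0 (S (hd t)).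

Definition len (l : nat) : nat :=
  nat_rect (fun _ => nat) 0 (fun i r => ifz (lookup l i) r (S r)) l.

Definition cut (t : nat) (x : baire) (i : nat) : nat := ifz (S i - t) (x i) 0.

Lemma hd_query n y k : hd (query n y k) = n.
Proof. rewrite query_prefix. apply p1_pair. Qed.

Lemma tl_query n y k : tl (query n y k) = prefix y k.
Proof. rewrite query_prefix. apply p2_pair. Qed.

Lemma lookup_prefix y k i :
  lookup (prefix y k) i = if i <? k then S (y i) else 0.
Proof.
  unfold lookup.
  assert (H : forall i, nat_rect (fun _ => nat) (prefix y k) (fun _ r => tl r) i =
    code_list (List.map y (List.seq i (k - i)))).
  { clear i. induction i as [|i IH]; simpl.
    - now rewrite Nat.sub_0_r.
    - rewrite IH. destruct (k - i) as [|d] eqn:E.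
      + replace (k - S i) with 0 by lia. reflexivity.
      + replace (k - S i) with d by lia. simpl. apply p2_pair. }
  rewrite H. destruct (Nat.ltb_spec i k) as [Hi|Hi].
  - destruct (k - i) as [|d] eqn:E; [lia|]. simpl. unfold hd. simpl.
    now rewrite p1_pair.
  - replace (k - i) with 0 by lia. reflexivity.
Qed.

Lemma cpair_ge_r a b : b <= cpair a b.
Proof. pose proof (Cantor.to_nat_non_decreasing a b). lia. Qed.

Lemma prefix_ge y k : k <= prefix y k.
Proof.
  unfold prefix. rewrite <- (List.length_seq k 0) at 1.
  generalize (List.seq 0 k). intros l. induction l as [|n l IH]; simpl; [lia|].
  pose proof (cpair_ge_r (y n) (code_list (List.map y l))). lia.
Qed.

Lemma len_prefix y k : len (prefix y k) = k.
Proof.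
  unfold len.
  assert (H : forall j, nat_rect (fun _ => nat) 0
    (fun i r => ifz (lookup (prefix y k) i) r (S r)) j = min j k).
  { induction j as [|j IH]; trivial. simpl nat_rect. rewrite IH, lookup_prefix.
    destruct (Nat.ltb_spec j k); simpl ifz; lia. }
  rewrite H. pose proof (prefix_ge y k). lia.
Qed.

(** Exactly the first [t] entries are known, which is what a prefix of length [t]
    tells; any longer prefix gives the same information after cutting. *)
Definition stage (x : baire) (t : nat) : baire := cut t (fun i => S (x i)).

Lemma stage_lookup x k : lookup (prefix x k) = stage x k.
Proof.
  extensionality i. rewrite lookup_prefix. unfold stage, cut.
  destruct (Nat.ltb_spec i k).
  - now replace (S i - k) with 0 by lia.
  - now replace (S i - k) with (S (i - k)) by lia.
Qed.

Lemma cut_lookup x k t : t <= k -> cut t (lookup (prefix x k)) = stage x t.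
Proof.
  intros H. extensionality i. unfold stage, cut.
  destruct (S i - t) as [|d] eqn:E; trivial. simpl. rewrite lookup_prefix.
  destruct (Nat.ltb_spec i k); [trivial | lia].
Qed.

Lemma approx_stage x : approx (stage x) x.
Proof.
  unfold stage, cut. split.
  - intros t i v. destruct (S i - t); simpl; congruence.
  - intros i. exists (S i). intros t Ht. now replace (S i - t) with 0 by lia.
Qed.

Definition computable2 (X : nat -> baire) : Prop :=
  computable (fun w => X (p1 w) (p2 w)).

Lemma computable2_app X a b :
  computable2 X -> computable a -> computable b -> computable (fun w => X (a w) (b w)).
Proof. apply computable_binary. Qed.

Lemma computable2_shift X a :
  computable2 X -> computable a -> computable2 (fun w => X (a w)).
Proof.
  intros HX Ha. apply (computable2_app HX); auto with comp.
  apply computable_compose with (f := a); auto with comp.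
Qed.

Lemma computable_sub a b :
  computable a -> computable b -> computable (fun w => a w - b w).
Proof.
  intros Ha Hb. apply computable_ext with
    (f := fun w => nat_rect (fun _ => nat) (a w) (fun _ r => pred r) (b w)).
  - intros w. induction (b w) as [|k IH]; simpl; [lia|]. rewrite IH. lia.
  - apply (computable_rec (g := fun _ _ r => pred r)); auto with comp.
Qed.

Lemma computable_double : computable (fun w => 2 * w).
Proof.
  apply computable_ext with
    (f := fun w => nat_rect (fun _ => nat) w (fun _ r => S r) w).
  - intros w. replace (2 * w) with (w + w) by lia. generalize w at 2 4.
    intros k. induction k as [|k IH]; simpl; [lia|]. rewrite IH. lia.
  - apply (computable_rec (g := fun _ _ r => S r)); auto with comp.
Qed.

Local Hint Resolve computable_sub : comp.

Lemma computable_tl f : computable f -> computable (fun w => tl (f w)).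
Proof. unfold tl. auto with comp. Qed.

Lemma computable_hd f : computable f -> computable (fun w => hd (f w)).
Proof. unfold hd. auto with comp. Qed.

Lemma computable2_lookup : computable2 lookup.
Proof.
  unfold computable2, lookup.
  assert (H : computable (fun w => nat_rect (fun _ => nat) (p1 w)
    (fun _ r => tl r) (p2 w))).
  { apply (computable_rec (g := fun _ _ r => tl r)); auto with comp.
    apply computable_tl; auto with comp. }
  apply computable_ifz; auto with comp. apply computable_S.
  now apply computable_hd.
Qed.

Lemma computable_len f : computable f -> computable (fun w => len (f w)).
Proof.
  intros Hf. unfold len.
  apply (computable_rec (g := fun w i r => ifz (lookup (f w) i) r (S r)));
    auto with comp.
  apply computable_ifz; auto with comp.
  apply (computable2_app computable2_lookup); auto with comp.
  apply computable_compose with (f := f); auto with comp.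
Qed.

Lemma computable2_cut t X :
  computable t -> computable2 X -> computable2 (fun w => cut (t w) (X w)).
Proof.
  intros Ht HX. unfold computable2, cut.
  apply computable_ifz; auto with comp. apply computable_sub; auto with comp.
  apply computable_compose with (f := t); auto with comp.
Qed.

Lemma computable_guarded_prefix Y k :
  computable2 Y -> computable k -> computable (fun w => guarded_prefix (Y w) (k w)).
Proof.
  intros HY Hk. unfold guarded_prefix.
  apply (computable_rec (g := fun w i r =>
    ifz r 0 (ifz (Y w (k w - S i)) 0 (S (S (cpair (pred (Y w (k w - S i))) (pred r)))))));
    auto with comp.
  assert (H : computable (fun u => Y (p1 u) (k (p1 u) - S (p1 (p2 u))))).
  { apply (computable2_app HY); auto with comp.
    apply computable_sub; auto with comp.
    apply computable_compose with (f := k); auto with comp. }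
  auto 10 with comp.
Qed.

Lemma computable_probe X Y n k :
  computable2 X -> computable2 Y -> computable n -> computable k ->
  computable (fun w => probe (X w) (Y w) (n w) (k w)).
Proof.
  intros HX HY Hn Hk. unfold probe.
  pose proof (computable_guarded_prefix HY Hk) as HP.
  assert (HQ : computable (fun w =>
    X w (S (cpair (n w) (pred (guarded_prefix (Y w) (k w))))))).
  { apply (computable2_app HX); auto with comp. }
  auto 8 with comp.
Qed.

Lemma computable_apply_approx X Y t n :
  computable2 X -> computable2 Y -> computable t -> computable n ->
  computable (fun w => apply_approx (X w) (Y w) (t w) (n w)).
Proof.
  intros HX HY Ht Hn. unfold apply_approx, search. apply computable_pred.
  apply (computable_rec (g := fun w k r => ifz r (probe (X w) (Y w) (n w) k) r));
    auto with comp.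
  assert (Hn' : computable (fun u => n (p1 u))).
  { apply computable_compose with (f := n); auto with comp. }
  pose proof (@computable_probe (fun u => X (p1 u)) (fun u => Y (p1 u))
    (fun u => n (p1 u)) (fun u => p1 (p2 u))) as H.
  apply computable_ifz; auto with comp. apply H; auto with comp;
    apply computable2_shift; auto with comp.
Qed.

(** Operators act on stages of three arguments, at a given time and position. *)
Definition operator : Type := baire -> baire -> baire -> nat -> baire.

(** Computability of an operator is stated as closure under substitution of
    computable families of stages, which composes without coding functions. *)
Definition computable_operator (F : operator) : Prop :=
  forall X Y Z t n, computable2 X -> computable2 Y -> computable2 Z ->
    computable t -> computable n ->
    computable (fun w => F (X w) (Y w) (Z w) (t w) (n w)).

(** An element that waits for a prefix of length [t n] before answering [u n]. *)
Lemma app2_wait C a u (t : baire) :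
  (forall n k, C (query n a k) = ifz (t n - k) (S (u n)) 0) -> app2 C a u.
Proof.
  intros H n. exists (t n). split.
  - now rewrite H, Nat.sub_diag.
  - intros i Hi. rewrite H. now replace (t n - i) with (S (t n - i - 1)) by lia.
Qed.

(** A query to the innermost value carries a prefix of [c], of length [t] say, and
    the computation on this query is run for [t] steps on the first [t] entries of
    all three arguments. So its value depends on prefixes of [a] and [b] of a
    length that can be read off from the query, and the outer two levels need only
    wait until they have received prefixes of that length; longer prefixes are
    cut, so that the answer does not depend on how much has been read. *)
Lemma curry_operator (F : operator) : computable_operator F ->
  exists C, computable C /\
    forall a, exists u, app2 C a u /\
    forall b, exists v, app2 u b v /\
    forall c z, approx (fun t => F (stage a t) (stage b t) (stage c t) t) z ->
      app2 v c z.
Proof.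
  intros HF.
  pose (time := fun m => len (tl m)).
  pose (result := fun a b m => F a b (lookup (tl m)) (time m) (hd m)).
  pose (v := fun a b m => result (stage a (time m)) (stage b (time m)) m).
  pose (u := fun a q => ifz (time (hd q) - time q)
    (S (result (stage a (time (hd q))) (cut (time (hd q)) (lookup (tl q))) (hd q))) 0).
  pose (C := fun q => let q' := hd q in let m := hd q' in
    ifz (time m - time q)
      (S (ifz (time m - time q')
        (S (result (cut (time m) (lookup (tl q))) (cut (time m) (lookup (tl q'))) m))
        0)) 0).
  assert (Etime : forall n x k, time (query n x k) = k).
  { intros n x k. unfold time. now rewrite tl_query, len_prefix. }
  assert (Ecut : forall t n x k, t - k = 0 ->
    cut t (lookup (tl (query n x k))) = stage x t).
  { intros t n x k H. rewrite tl_query. apply cut_lookup. lia. }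
  exists C. split.
  { assert (H : forall f, computable f -> computable2 (fun w => lookup (tl (f w)))).
    { intros f Hf. apply computable2_shift; [apply computable2_lookup|].
      now apply computable_tl. }
    assert (Htime : forall f, computable f -> computable (fun w => time (f w))).
    { intros f Hf. now apply computable_len, computable_tl. }
    pose proof computable_id as Hid.
    pose proof (computable_hd Hid) as Hq'.
    pose proof (computable_hd Hq') as Hm.
    unfold C. cbv zeta. apply computable_ifz; auto with comp.
    apply computable_S, computable_ifz; auto with comp.
    apply computable_S. unfold result.
    apply HF; auto using computable_hd; apply computable2_cut; auto. }
  intros a. exists (u a). split.
  { apply app2_wait with (t := fun q' => time (hd q')). intros q' k.
    unfold C, u. cbv zeta. rewrite hd_query, Etime.
    destruct (time (hd q') - k) as [|d] eqn:E; trivial. now rewrite Ecut. }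
  intros b. exists (v a b). split.
  { apply app2_wait with (t := time). intros m k.
    unfold u, v. rewrite hd_query, Etime.
    destruct (time m - k) as [|d] eqn:E; trivial. now rewrite Ecut. }
  intros c z [Hsound Hlim] n.
  assert (Ev : forall k, v a b (query n c k) =
    F (stage a k) (stage b k) (stage c k) k n).
  { intros k. unfold v, result.
    now rewrite Etime, hd_query, tl_query, stage_lookup. }
  destruct (Hlim n) as [T HT]. specialize (HT T (le_n T)).
  destruct (@least_zero (fun k => ifz (v a b (query n c k)) 1 0) T)
    as (k & Hk & Hlt); [now rewrite Ev, HT|].
  exists k. split.
  - rewrite Ev in Hk |- *.
    destruct (F (stage a k) (stage b k) (stage c k) k n) as [|w] eqn:E;
      [discriminate|]. f_equal. eapply Hsound, E.
  - intros i Hi. destruct (Hlt i Hi) as [r Hr].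
    now destruct (v a b (query n c i)).
Qed.

(** * Kleene's second algebra and the Kleene-Vesley algebra *)

Lemma app2_fun x y z z' : app2 x y z -> app2 x y z' -> z = z'.
Proof.
  intros H H'. extensionality n.
  destruct (H n) as (k & Hk & Hlt), (H' n) as (k' & Hk' & Hlt').
  destruct (lt_eq_lt_dec k k') as [[Hl|<-]|Hl].
  - rewrite (Hlt' k Hl) in Hk. discriminate.
  - congruence.
  - rewrite (Hlt k' Hl) in Hk'. discriminate.
Qed.

(** The computable sequences form a subalgebra: wait for the first positive
    answer. *)
Lemma computable_app2_closed x y z :
  computable x -> computable y -> app2 x y z -> computable z.
Proof.
  intros Hx Hy Hz.
  pose (ask := fun w => x (query (p1 w) y (p2 w))).
  assert (Hask : computable ask).
  { unfold ask. apply computable_compose with (f := x); trivial.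
    apply computable_ext with
      (f := fun w => S (cpair (p1 w) (pred (guarded_prefix (fun i => S (y i)) (p2 w))))).
    - intros w.
      rewrite (@guarded_prefix_full _ y); [reflexivity | congruence | discriminate].
    - assert (H : computable (fun w => guarded_prefix (fun i => S (y i)) (p2 w))).
      { apply (@computable_guarded_prefix (fun _ i => S (y i))); auto with comp.
        apply computable_S, computable_compose with (f := y); auto with comp. }
      auto 8 with comp. }
  assert (Htest : computable (fun w => ifz (ask w) 1 0)) by auto with comp.
  assert (Hanswer : computable (fun w => pred (ask w))) by auto with comp.
  destruct Htest as [test Htest], Hanswer as [answer Hanswer].
  exists (Comp answer (Pair id_code (Mu test))). intros n.
  destruct (Hz n) as (k & Hk & Hlt).
  assert (Eask : forall i, ask (cpair n i) = x (query n y i)).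
  { intros i. unfold ask. now rewrite p1_pair, p2_pair. }
  exists (cpair n k). split.
  - exists n, k. split; [apply eval_id|]. split; [|reflexivity]. split.
    + specialize (Htest (cpair n k)). rewrite Eask, Hk in Htest. exact Htest.
    + intros i Hi. exists 0. specialize (Htest (cpair n i)).
      rewrite Eask, Hlt in Htest by trivial. exact Htest.
  - specialize (Hanswer (cpair n k)). rewrite Eask, Hk in Hanswer. exact Hanswer.
Qed.

(** An operator with fewer arguments comes from one that ignores its first argument,
    applied to some computable sequence. *)
Lemma curry_operator2 (G : baire -> baire -> nat -> baire) :
  computable_operator (fun _ => G) ->
  exists C, computable C /\
    forall a, exists u, app2 C a u /\
    forall b z, approx (fun t => G (stage a t) (stage b t) t) z -> app2 u b z.
Proof.
  intros HG. destruct (curry_operator HG) as (C & HC & H).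
  destruct (H (fun _ => 0)) as (D & HD & H'). exists D. split; [|exact H'].
  eapply computable_app2_closed; [exact HC | apply computable_const | exact HD].
Qed.

Lemma curry_operator1 (G : baire -> nat -> baire) :
  computable_operator (fun _ _ => G) ->
  exists C, computable C /\
    forall a z, approx (fun t => G (stage a t) t) z -> app2 C a z.
Proof.
  intros HG. destruct (curry_operator2 HG) as (C & HC & H).
  destruct (H (fun _ => 0)) as (D & HD & H'). exists D. split; [|exact H'].
  eapply computable_app2_closed; [exact HC | apply computable_const | exact HD].
Qed.

Lemma approx_reindex X x (f : baire) :
  approx X x -> approx (fun t n => X t (f n)) (fun n => x (f n)).
Proof. intros [H H']. split; [intros t i; apply H | intros i; apply H']. Qed.

Lemma div2_even_rec n :
  nat_rect (fun _ => nat) 0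
    (fun _ r => ifz (p2 r) (cpair (p1 r) 1) (cpair (S (p1 r)) 0)) n =
  cpair (Nat.div2 n) (if Nat.even n then 0 else 1).
Proof.
  induction n as [|n IH]; [reflexivity|]. cbn [nat_rect].
  rewrite IH, p1_pair, p2_pair, Nat.even_succ, <- Nat.negb_even.
  destruct (Nat.even n) eqn:E; simpl ifz; simpl negb; do 2 f_equal.
  - apply Nat.even_spec in E. now apply Nat.Even_div2.
  - apply Nat.Odd_div2, Nat.odd_spec. now rewrite <- Nat.negb_even, E.
Qed.

Lemma pair2_code : exists C, computable C /\
  forall a, exists u, app2 C a u /\ forall b, app2 u b (pair2 a b).
Proof.
  destruct (@curry_operator2 (fun A B t n =>
    if Nat.even n then A (Nat.div2 n) else B (Nat.div2 n))) as (C & HC & H).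
  - intros X Y Z t n _ HX HY _ Hn.
    assert (Hd : computable (fun m => nat_rect (fun _ => nat) 0
      (fun _ r => ifz (p2 r) (cpair (p1 r) 1) (cpair (S (p1 r)) 0)) m)).
    { apply (computable_rec
        (g := fun _ _ r => ifz (p2 r) (cpair (p1 r) 1) (cpair (S (p1 r)) 0)));
        auto 10 with comp. }
    pose proof (computable_compose Hd Hn) as Hdn.
    set (d := nat_rect _ _ _) in Hdn.
    apply computable_ext with (f := fun w =>
      ifz (p2 (d (n w))) (Y w (p1 (d (n w)))) (Z w (p1 (d (n w))))).
    + intros w. unfold d. rewrite div2_even_rec, p1_pair, p2_pair.
      now destruct (Nat.even (n w)).
    + apply computable_ifz; auto with comp;
        apply computable2_app; auto with comp.
  - exists C. split; trivial. intros a. destruct (H a) as (u & Hu & H').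
    exists u. split; trivial. intros b. apply H'.
    pose proof (approx_reindex Nat.div2 (approx_stage a)) as [Ha Ha'].
    pose proof (approx_reindex Nat.div2 (approx_stage b)) as [Hb Hb'].
    unfold pair2. split.
    + intros t n v. destruct (Nat.even n); [apply Ha | apply Hb].
    + intros n. destruct (Nat.even n); [apply Ha' | apply Hb'].
Qed.

Lemma reindex_code (f : baire) : computable f ->
  exists C, computable C /\ forall a, app2 C a (fun n => a (f n)).
Proof.
  intros Hf. destruct (@curry_operator1 (fun A t n => A (f n))) as (C & HC & H).
  - intros X Y Z t n _ _ HZ _ Hn. apply (computable2_app HZ); auto with comp.
    now apply computable_compose with (f := f).
  - exists C. split; trivial. intros a. apply H.
    apply approx_reindex, approx_stage.
Qed.

Lemma constant_code : exists C, computable C /\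
  forall a, exists u, app2 C a u /\ forall b, app2 u b a.
Proof.
  destruct (@curry_operator2 (fun A B t => A)) as (C & HC & H).
  - intros X Y Z t n _ HY _ _ Hn. apply (computable2_app HY); auto with comp.
  - exists C. split; trivial. intros a. destruct (H a) as (u & Hu & H').
    exists u. split; trivial. intros b. apply H', approx_stage.
Qed.

Lemma substitution_code : exists C, computable C /\
  forall a, exists u, app2 C a u /\
  forall b, exists v, app2 u b v /\
  forall c d e r, app2 a c d -> app2 b c e -> app2 d e r -> app2 v c r.
Proof.
  destruct (@curry_operator (fun A B C t =>
    apply_approx (apply_approx A C t) (apply_approx B C t) t)) as (C & HC & H).
  - intros X Y Z t n HX HY HZ Ht Hn.
    assert (Hp1 : computable p1) by (apply computable_p1, computable_id).
    apply computable_apply_approx; trivial;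
      apply computable_apply_approx; auto using computable2_shift with comp;
      now apply computable_compose with (f := t).
  - exists C. split; trivial. intros a. destruct (H a) as (u & Hu & H').
    exists u. split; trivial. intros b. destruct (H' b) as (v & Hv & H'').
    exists v. split; trivial. intros c d e r Hd He Hr. apply H''.
    apply approx_apply with (x := d) (y := e); trivial.
    + apply approx_apply with (x := a) (y := c); auto using approx_stage.
    + apply approx_apply with (x := b) (y := c); auto using approx_stage.
Qed.

(** The combinators are computable, so they serve for both choices of realizers,
    all sequences and the computable ones. *)
Lemma pca_baire (E : baire -> Prop) :
  (forall x, computable x -> E x) ->
  (forall x y z, E x -> E y -> app2 x y z -> E z) ->
  inhabited (pca (@Algebra baire E app2 pair2)).
Proof.
  intros HE Happ.
  destruct constant_code as (k & Hk & Kspec), substitution_code as (s & Hs & Sspec),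
    pair2_code as (p & Hp & Pspec),
    (reindex_code computable_double) as (f & Hf & Fspec),
    (reindex_code (computable_S computable_double)) as (g & Hg & Gspec).
  constructor. apply (@Pca (@Algebra baire E app2 pair2))
    with (kc := k) (sc := s) (pairc := p) (fstc := f) (sndc := g); simpl; auto.
  - exact app2_fun.
  - repeat split; auto.
  - intros a b. replace a with (fun n => pair2 a b (2 * n)) at 2; [apply Fspec|].
    extensionality n. unfold pair2. rewrite Nat.even_even.
    f_equal. apply Nat.div2_double.
  - intros a b. replace b with (fun n => pair2 a b (S (2 * n))) at 2; [apply Gspec|].
    extensionality n. unfold pair2.
    now rewrite Nat.even_succ, Nat.odd_even, Nat.div2_succ_double.
Qed.

Lemma pca_algebra_of (K : kleene_case) : inhabited (pca (algebra_of K)).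
Proof.
  destruct K.
  - exact pca_kleene1.
  - apply pca_baire; simpl; auto.
  - apply pca_baire.
    + intros x. apply computable_seq_iff.
    + intros x y z. rewrite !computable_seq_iff. apply computable_app2_closed.
Qed.

Theorem corollary5p31 (K : kleene_case) :
  heyting (degree_le (@weihrauch_le (algebra_of K))) /\
  order_isomorphic (degree_le (@weihrauch_le (algebra_of K)))
                   (degree_le (@r_le (algebra_of K))).
Proof.
  destruct (pca_algebra_of K) as [P]. exact (weihrauch_degrees_of_pca P).
Qed.
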